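(* Let $\zeta(s)=\sum_{n=1}^{\infty} n^{-s}$ for complex $s$ with $\Re(s)>1$. There is an analytic continuation of $\zeta(s)$ to the entire complex plane, where it is analytic apart from a simple pole at $s=1$ with residue $1$. Moreover, for all integers $k\ge 1$, the continued function (still denoted $\zeta$) satisfies $$\zeta(-k)=-\frac{B_{k+1}}{k+1},$$ where $B_n$ denotes the $n$-th Bernoulli number.
   Context: The Bernoulli numbers $(B_n)_{n\ge 0}$ are defined via the generating function $$\frac{x}{e^x-1}=\sum_{n=0}^\infty B_n\frac{x^n}{n!},$$ so that $B_0=1$, $B_1=-\tfrac12$, $B_2=\tfrac16$. The function $\zeta(s)$ is initially defined only by the series $\sum_{n\ge1} n^{-s}$ on the half-plane $\Re(s)>1$; the theorem asserts the existence of its continuation to $\mathbb{C}\setminus\{1\}$. *)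

(* Defs.v *)
From Stdlib Require Import Reals Lra Lia Arith.
From Coquelicot Require Import Coquelicot.

Open Scope R_scope.

(* The generating function is required on a punctured neighbourhood of 0 only:
   at 0 the quotient is a removable singularity. *)
Definition bernoulli_numbers (B : nat -> R) : Prop :=
  locally' (0 : R)
    (fun x => is_pseries (fun n => B n / INR (fact n)) x (x / (exp x - 1))).

Definition Cexp (z : C) : C :=
  (exp (Re z) * cos (Im z), exp (Re z) * sin (Im z)).

(* [n ^ s], principal determination; meant for [n >= 1] *)
Definition nat_Cpower (n : nat) (s : C) : C :=
  Cexp (s * RtoC (ln (INR n)))%C.

Definition analytic_at (f : C -> C) (z : C) : Prop :=
  locally z (fun w => ex_derive f w).

(* the principal part of [f] at [a] is [r / (z - a)], with [r] nonzero *)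
Definition simple_pole_with_residue (f : C -> C) (a r : C) : Prop :=
  r <> RtoC 0 /\
  exists g : C -> C,
    analytic_at g a /\
    locally' a (fun z => f z = (r / (z - a) + g z)%C).

Fixpoint bern_table (n : nat) : nat -> R :=
  match n with
  | O => fun _ => 1
  | S m => fun k =>
      if Nat.leb k m then bern_table m k
      else - sum_f_R0 (fun j => bern_table m j * / INR (fact (S (S m - j)))) m
  end.

Definition bern_coef (n : nat) : R := bern_table n n.

Lemma bern_table_coef n k : (k <= n)%nat -> bern_table n k = bern_coef k.
Proof.
induction n as [|n IH]; intros Hk.
- now replace k with O by lia.
- destruct (Nat.eq_dec k (S n)) as [->|Hne]; [reflexivity|].
  simpl. replace (Nat.leb k n) with true.
  + apply IH; lia.
  + symmetry; apply Nat.leb_le; lia.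
Qed.

Lemma bern_coef_S m :
  bern_coef (S m)
  = - sum_f_R0 (fun j => bern_coef j * / INR (fact (S (S m - j)))) m.
Proof.
unfold bern_coef at 1. cbn [bern_table].
replace (Nat.leb (S m) m) with false
  by (symmetry; apply Nat.leb_gt; lia).
f_equal. apply sum_eq. intros i Hi. now rewrite bern_table_coef.
Qed.

Lemma inv_fact_pos n : 0 < / INR (fact n).
Proof. apply Rinv_0_lt_compat, INR_fact_lt_0. Qed.

Lemma inv_fact_le n : / INR (fact (S n)) <= (/ 2) ^ n.
Proof.
induction n as [|n IH]; [simpl; lra|].
rewrite fact_simpl, mult_INR, Rinv_mult.
change ((/ 2) ^ S n) with (/ 2 * (/ 2) ^ n).
apply Rmult_le_compat; [| |apply Rinv_le_contravar|exact IH].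
- apply Rlt_le, Rinv_0_lt_compat, lt_0_INR; lia.
- apply Rlt_le, inv_fact_pos.
- lra.
- replace 2 with (INR 2) by (simpl; lra). apply le_INR; lia.
Qed.

Lemma sum_inv_fact_le m :
  sum_f_R0 (fun j => / INR (fact (S (S m - j)))) m <= 1 - (/ 2) ^ S m.
Proof.
induction m as [|m IH].
- pose proof (inv_fact_le 1). simpl in *. lra.
- rewrite decomp_sum by lia. rewrite Nat.sub_0_r, Nat.pred_succ.
  pose proof (inv_fact_le (S (S m))) as H.
  change (sum_f_R0 (fun i => / INR (fact (S (S (S m) - S i)))) m)
    with (sum_f_R0 (fun i => / INR (fact (S (S m - i)))) m).
  simpl pow in *. lra.
Qed.

Lemma bern_coef_bound n : Rabs (bern_coef n) <= 1.
Proof.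
induction n as [n IH] using lt_wf_ind.
destruct n as [|m].
- unfold bern_coef; simpl. rewrite Rabs_R1; lra.
- rewrite bern_coef_S, Rabs_Ropp.
  eapply Rle_trans; [apply Rsum_abs|].
  apply Rle_trans with (sum_f_R0 (fun j => / INR (fact (S (S m - j)))) m).
  + apply sum_Rle. intros j Hj.
    rewrite Rabs_mult, (Rabs_pos_eq (/ _)) by (apply Rlt_le, inv_fact_pos).
    rewrite <- (Rmult_1_l (/ INR (fact (S (S m - j))))) at 2.
    apply Rmult_le_compat_r; [apply Rlt_le, inv_fact_pos|apply IH; lia].
  + pose proof (sum_inv_fact_le m).
    pose proof (pow_lt (/ 2) (S m) ltac:(lra)). lra.
Qed.

Lemma CV_radius_ge_1 (a : nat -> R) :
  (forall n, Rabs (a n) <= 1) -> Rbar_le 1 (CV_radius a).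
Proof.
intros Ha. apply (proj1 (CV_radius_bounded a)).
exists 1. intros n. now rewrite pow1, Rmult_1_r.
Qed.

Lemma bernoulli_numbers_exist : exists B, bernoulli_numbers B.
Proof.
exists (fun n => bern_coef n * INR (fact n)).
exists (mkposreal 1 Rlt_0_1). intros x Hx Hx0.
assert (Hx1 : Rabs x < 1).
{ unfold ball in Hx; simpl in Hx.
  unfold AbsRing_ball, abs, minus, plus, opp in Hx; simpl in Hx.
  now replace x with (x + - 0) by ring. }
set (c := PS_decr_1 (fun n => / INR (fact n))).
assert (Ra : Rbar_lt (Rabs x) (CV_radius bern_coef)).
{ eapply Rbar_lt_le_trans; [|apply CV_radius_ge_1, bern_coef_bound]. exact Hx1. }
assert (Rc : Rbar_lt (Rabs x) (CV_radius c)).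
{ eapply Rbar_lt_le_trans; [|apply CV_radius_ge_1]; [exact Hx1|].
  intros n. unfold c, PS_decr_1.
  rewrite Rabs_pos_eq by (apply Rlt_le, inv_fact_pos).
  eapply Rle_trans; [apply inv_fact_le|].
  rewrite <- (pow1 n). apply pow_incr; lra. }
pose proof (PSeries_correct _ _ (CV_radius_inside _ _ Ra)) as Ha.
pose proof (PSeries_correct _ _ (CV_radius_inside _ _ Rc)) as Hc.
set (la := PSeries bern_coef x) in *. set (lc := PSeries c x) in *.
pose proof (is_pseries_mult _ _ _ _ _ Ha Hc Ra Rc) as Hm.
set (d := fun n : nat => match n with O => 1 | S _ => 0 end).
assert (Hd : forall n, PS_mult bern_coef c n = d n).
{ intros [|m]; unfold PS_mult, d.
  - simpl. unfold c, PS_decr_1, bern_coef. simpl. field.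
  - rewrite tech5, bern_coef_S, Nat.sub_diag.
    replace (c O) with 1 by (unfold c, PS_decr_1; simpl; symmetry; apply Rinv_1).
    unfold c, PS_decr_1. ring. }
assert (E1 : la * lc = 1).
{ apply (is_pseries_ext _ d _ _ Hd) in Hm.
  rewrite <- (is_pseries_unique _ _ _ Hm).
  rewrite PSeries_decr_1 by (now exists (la * lc)).
  rewrite (PSeries_ext (PS_decr_1 d) (fun _ => 0)) by reflexivity.
  rewrite PSeries_const_0. simpl. ring. }
assert (E2 : exp x = 1 + x * lc).
{ rewrite <- (is_pseries_unique _ _ _ (is_exp_Reals x)).
  rewrite PSeries_decr_1 by (exists (exp x); apply is_exp_Reals).
  fold c. fold lc. simpl. field. }
assert (Hlc : lc <> 0) by (intros H0; rewrite H0 in E1; lra).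
replace (x / (exp x - 1)) with la.
- apply is_pseries_ext with (2 := Ha). intros n.
  change (bern_coef n = bern_coef n * INR (fact n) / INR (fact n) :> R).
  field. apply INR_fact_neq_0.
- rewrite E2. apply Rmult_eq_reg_r with lc; [|exact Hlc].
  rewrite E1. field.
  intros H. apply Hx0. apply Rmult_eq_reg_r with lc; [|exact Hlc]. lra.
Qed.

(* Main.v *)
(** Euler-Maclaurin summation. Write [b_j = B_j / j!], [P_j(t) = B_j(t) / j!],
    let [F_1(x) = x^(-s)], let [F_0] be minus its antiderivative vanishing at
    [x = 1] (entire in [s]), and let [F_(j+1) = - F_j'].  Since [P_j' = P_(j-1)],
    the sum [sum_(j <= N) P_j(t) F_j(x + t)] has [t]-derivative
    [- P_N(t) F_(N+1)(x + t)], so its increment over [0 <= t <= 1], which is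
    [d_N(s, x) = E_N(s, x + 1) - E_N(s, x) + (x + 1)^(-s)] with
    [E_N = sum_(j <= N) b_j F_j], is [O(x^(- Re s - N))].  Hence
    [zeta(s) = 1 / (s - 1) + 1 + E_N(s, 1) + sum_(n >= 1) d_N(s, n)] converges for
    [Re s + N > 1], independently of [N], to the sum of [n^(-s)] when [Re s > 1].
    At [s = -k] the factor [s (s + 1) ... (s + N - 1)] of [F_(N+1)] vanishes for
    [N > k], so the series drops out, and [E_N(-k, 1)] is evaluated with the
    recurrence and the parity of the Bernoulli numbers. *)

Require Import Defs.
From Stdlib Require Import Reals Lra Lia Arith ZArith ClassicalEpsilon.
From Coquelicot Require Import Coquelicot.

Open Scope R_scope.

(** * Limits and sums of complex sequences *)

Lemma Cmod_le_Re_Im (z : C) : Cmod z <= Rabs (Re z) + Rabs (Im z).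
Proof.
destruct z as [x y]; simpl.
replace (x, y) with (RtoC x + Ci * RtoC y)%C
  by (unfold Ci, RtoC, Cplus, Cmult; simpl; f_equal; ring).
eapply Rle_trans; [apply Cmod_triangle|].
rewrite Cmod_mult, !Cmod_R.
replace (Cmod Ci) with 1; [lra|].
unfold Cmod, Ci; simpl. replace (0 * (0 * 1) + 1 * (1 * 1)) with 1 by ring.
now rewrite sqrt_1.
Qed.

Lemma Re_le_Cmod (z : C) : Rabs (Re z) <= Cmod z.
Proof. eapply Rle_trans; [apply Rmax_l|apply Rmax_Cmod]. Qed.

Lemma Im_le_Cmod (z : C) : Rabs (Im z) <= Cmod z.
Proof. eapply Rle_trans; [apply Rmax_r|apply Rmax_Cmod]. Qed.

Lemma Cmod_minus_sym (z w : C) : Cmod (z - w) = Cmod (w - z).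
Proof. rewrite <- Cmod_opp. f_equal. ring. Qed.

Lemma C_eq_Re_Im (z w : C) : Re z = Re w -> Im z = Im w -> z = w.
Proof. destruct z, w; simpl; congruence. Qed.

(** Convergence is coordinatewise, so that the limit lemmas for real sequences apply directly.
    [is_series_Ccv] converts the result to a series in the normed module [C]. *)
Definition Ccv (u : nat -> C) (l : C) : Prop :=
  is_lim_seq (fun n => Re (u n)) (Re l) /\ is_lim_seq (fun n => Im (u n)) (Im l).

Lemma Ccv_ext (u v : nat -> C) (l : C) :
  (forall n, u n = v n) -> Ccv u l -> Ccv v l.
Proof.
intros E [H1 H2]; split.
- apply is_lim_seq_ext with (2 := H1). intros n; now rewrite E.
- apply is_lim_seq_ext with (2 := H2). intros n; now rewrite E.
Qed.

Lemma Ccv_unique (u : nat -> C) (l m : C) : Ccv u l -> Ccv u m -> l = m.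
Proof.
intros [H1 H2] [H3 H4]. apply C_eq_Re_Im.
- apply is_lim_seq_unique in H1, H3. congruence.
- apply is_lim_seq_unique in H2, H4. congruence.
Qed.

Lemma Ccv_const (a : C) : Ccv (fun _ => a) a.
Proof. split; apply is_lim_seq_const. Qed.

Lemma Ccv_plus (u v : nat -> C) (l m : C) :
  Ccv u l -> Ccv v m -> Ccv (fun n => u n + v n)%C (l + m)%C.
Proof.
intros [H1 H2] [H3 H4]; split; simpl.
- exact (is_lim_seq_plus' _ _ _ _ H1 H3).
- exact (is_lim_seq_plus' _ _ _ _ H2 H4).
Qed.

Lemma Ccv_scal (a : C) (u : nat -> C) (l : C) :
  Ccv u l -> Ccv (fun n => a * u n)%C (a * l)%C.
Proof.
intros [H1 H2]; split; simpl.
- apply is_lim_seq_minus'; apply (is_lim_seq_scal_l _ _ (Finite _)); assumption.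
- apply is_lim_seq_plus'; apply (is_lim_seq_scal_l _ _ (Finite _)); assumption.
Qed.

Lemma Ccv_minus (u v : nat -> C) (l m : C) :
  Ccv u l -> Ccv v m -> Ccv (fun n => u n - v n)%C (l - m)%C.
Proof.
intros H1 H2. replace (l - m)%C with (l + (-(1)) * m)%C by ring.
apply Ccv_ext with (fun n => u n + (-(1)) * v n)%C; [intros; ring|].
now apply Ccv_plus, Ccv_scal.
Qed.

Lemma Ccv_S (u : nat -> C) (l : C) : Ccv u l <-> Ccv (fun n => u (S n)) l.
Proof.
unfold Ccv.
rewrite (is_lim_seq_incr_1 (fun n => Re (u n))).
now rewrite (is_lim_seq_incr_1 (fun n => Im (u n))).
Qed.

Lemma Ccv_0 (u : nat -> C) (e : nat -> R) :
  (forall n, Cmod (u n) <= e n) -> is_lim_seq e 0 -> Ccv u 0.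
Proof.
intros Hu He.
assert (He' : is_lim_seq (fun n => - e n) 0).
{ replace (Finite 0) with (Rbar_opp 0) by (simpl; f_equal; ring).
  now apply -> is_lim_seq_opp. }
split.
- apply is_lim_seq_le_le with (2 := He') (3 := He). intros n.
  apply Rabs_le_between. eapply Rle_trans; [apply Re_le_Cmod|apply Hu].
- apply is_lim_seq_le_le with (2 := He') (3 := He). intros n.
  apply Rabs_le_between. eapply Rle_trans; [apply Im_le_Cmod|apply Hu].
Qed.

Lemma is_lim_seq_Rabs_le (u : nat -> R) (l c B : R) (N : nat) :
  is_lim_seq u l -> (forall n, (N <= n)%nat -> Rabs (u n - c) <= B) ->
  Rabs (l - c) <= B.
Proof.
intros Hu HB.
assert (H : is_lim_seq (fun n => Rabs (u n - c)) (Rabs (l - c))).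
{ apply (is_lim_seq_abs _ (Finite _)). apply is_lim_seq_minus'; [exact Hu|].
  apply is_lim_seq_const. }
apply (is_lim_seq_le_loc _ (fun _ => B) _ _) with (2 := H)
  (3 := is_lim_seq_const B).
now exists N.
Qed.

(** The factor 2 is the price of passing to the limit in each coordinate separately. *)
Lemma Ccv_Cmod_le (u : nat -> C) (l c : C) (B : R) (N : nat) :
  Ccv u l -> (forall n, (N <= n)%nat -> Cmod (u n - c) <= B) ->
  Cmod (l - c) <= 2 * B.
Proof.
intros [H1 H2] HB.
eapply Rle_trans; [apply Cmod_le_Re_Im|].
enough (Rabs (Re (l - c)) <= B /\ Rabs (Im (l - c)) <= B) by lra.
split; simpl.
- apply is_lim_seq_Rabs_le with (1 := H1) (N := N). intros n Hn.
  eapply Rle_trans; [|apply (HB n Hn)]. apply (Re_le_Cmod (u n - c)).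
- apply is_lim_seq_Rabs_le with (1 := H2) (N := N). intros n Hn.
  eapply Rle_trans; [|apply (HB n Hn)]. apply (Im_le_Cmod (u n - c)).
Qed.

Fixpoint Cpsum (u : nat -> C) (n : nat) : C :=
  match n with O => u O | S m => (Cpsum u m + u (S m))%C end.

Lemma Cpsum_ext (u v : nat -> C) (n : nat) :
  (forall k, (k <= n)%nat -> u k = v k) -> Cpsum u n = Cpsum v n.
Proof.
induction n as [|n IH]; intros H; simpl; [apply H; lia|].
rewrite IH by (intros; apply H; lia). now rewrite H.
Qed.

Lemma Cpsum_minus (u v : nat -> C) (n : nat) :
  Cpsum (fun k => u k - v k)%C n = (Cpsum u n - Cpsum v n)%C.
Proof. induction n as [|n IH]; simpl; [reflexivity|]. rewrite IH. ring. Qed.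

Lemma Cpsum_scal (a : C) (u : nat -> C) (n : nat) :
  Cpsum (fun k => a * u k)%C n = (a * Cpsum u n)%C.
Proof. induction n as [|n IH]; simpl; [reflexivity|]. rewrite IH. ring. Qed.

Lemma Re_Cpsum (u : nat -> C) (n : nat) :
  Re (Cpsum u n) = sum_n (fun k => Re (u k)) n.
Proof.
induction n as [|n IH]; simpl; [now rewrite sum_O|].
rewrite sum_Sn. unfold Re in *. rewrite IH. reflexivity.
Qed.

Lemma Im_Cpsum (u : nat -> C) (n : nat) :
  Im (Cpsum u n) = sum_n (fun k => Im (u k)) n.
Proof.
induction n as [|n IH]; simpl; [now rewrite sum_O|].
rewrite sum_Sn. unfold Im in *. rewrite IH. reflexivity.
Qed.

Lemma Cpsum_tail_bound (u : nat -> C) (M : nat -> R) (K n : nat) :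
  (forall k, Cmod (u k) <= M k) -> (K <= n)%nat ->
  Cmod (Cpsum u n - Cpsum u K) <= sum_n M n - sum_n M K.
Proof.
intros HM Hn. induction Hn as [|n Hn IH].
- replace (Cpsum u K - Cpsum u K)%C with (RtoC 0) by ring.
  rewrite Cmod_0. lra.
- rewrite sum_Sn. unfold plus; simpl.
  replace (Cpsum u n + u (S n) - Cpsum u K)%C
    with ((Cpsum u n - Cpsum u K) + u (S n))%C by ring.
  eapply Rle_trans; [apply Cmod_triangle|]. specialize (HM (S n)). lra.
Qed.

(** This is total because [Series] is; it is known to be the sum only under a majorant, as in
    [Csum_cv]. *)
Definition Csum (u : nat -> C) : C :=
  (Series (fun n => Re (u n)), Series (fun n => Im (u n))).

Lemma Csum_cv (u : nat -> C) (M : nat -> R) :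
  (forall n, Cmod (u n) <= M n) -> ex_series M -> Ccv (Cpsum u) (Csum u).
Proof.
intros Hu HM. split; simpl.
- apply is_lim_seq_ext with (sum_n (fun k => Re (u k))).
  { intros n; now rewrite Re_Cpsum. }
  apply Series_correct.
  apply (@ex_series_le R_AbsRing R_CompleteNormedModule) with (2 := HM).
  intros n. eapply Rle_trans; [apply Re_le_Cmod|apply Hu].
- apply is_lim_seq_ext with (sum_n (fun k => Im (u k))).
  { intros n; now rewrite Im_Cpsum. }
  apply Series_correct.
  apply (@ex_series_le R_AbsRing R_CompleteNormedModule) with (2 := HM).
  intros n. eapply Rle_trans; [apply Im_le_Cmod|apply Hu].
Qed.

Lemma is_series_Ccv (u : nat -> C) (l : C) :
  Ccv (Cpsum u) l -> @is_series C_AbsRing C_NormedModule u l.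
Proof.
intros [H1 H2]. unfold is_series.
assert (E : forall n, sum_n (u : nat -> C_NormedModule) n = Cpsum u n).
{ induction n as [|n IH]; simpl; [now rewrite sum_O|].
  rewrite sum_Sn, IH. reflexivity. }
apply (filterlim_ext (Cpsum u)); [intros n; now rewrite E|].
apply filterlim_locally. intros eps.
apply is_lim_seq_spec in H1. apply is_lim_seq_spec in H2.
specialize (H1 eps). specialize (H2 eps).
destruct H1 as [N1 H1], H2 as [N2 H2].
exists (max N1 N2). intros n Hn.
split; [apply H1; lia|apply H2; lia].
Qed.

(** Since x + 1 <= 2 x for x >= 1, the term 1 / x^2 is at most 2 (1 / x - 1 / (x + 1)), which
    telescopes. This series is the majorant for all remainder sums below. *)
Lemma ex_series_inv_sqr (K : R) : ex_series (fun n => K / INR (S n) ^ 2).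
Proof.
apply (ex_series_scal K (fun n => / INR (S n) ^ 2)).
apply (@ex_series_le R_AbsRing R_CompleteNormedModule)
  with (fun n => 2 * (/ INR (S n) - / INR (S (S n)))).
- intros n. unfold norm; simpl norm. unfold abs; simpl abs.
  pose proof (lt_0_INR (S n) ltac:(lia)) as H.
  rewrite Rabs_pos_eq by (apply Rlt_le, Rinv_0_lt_compat, pow_lt, H).
  rewrite (S_INR (S n)). set (x := INR (S n)) in *.
  assert (1 <= x) by (apply (le_INR 1); lia).
  replace (2 * (/ x - / (x + 1))) with (/ (x ^ 2 * ((x + 1) / (2 * x))))
    by (field; lra).
  apply Rinv_le_contravar.
  + apply Rmult_lt_0_compat; [apply pow_lt, H|].
    apply Rdiv_lt_0_compat; lra.
  + rewrite <- (Rmult_1_r (x ^ 2)) at 2.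
    apply Rmult_le_compat_l; [apply Rlt_le, pow_lt, H|].
    apply Rle_div_l; lra.
- apply (ex_series_scal 2 (fun n => / INR (S n) - / INR (S (S n)))).
  exists 1.
  enough (H : is_lim_seq (sum_n (fun n => / INR (S n) - / INR (S (S n)))) 1)
    by exact H.
  apply (is_lim_seq_ext (fun n => 1 - / INR (S (S n)))).
  + induction n as [|n IH].
    * rewrite sum_O. simpl. field.
    * rewrite sum_Sn, <- IH. change (@plus _) with Rplus. cbv beta. ring.
  + replace (Finite 1) with (Finite (1 - 0)) by (f_equal; ring).
    apply is_lim_seq_minus'; [apply is_lim_seq_const|].
    apply (is_lim_seq_incr_1 (fun n => / INR (S n))).
    apply (is_lim_seq_incr_1 (fun n => / INR n)).
    apply (is_lim_seq_inv _ p_infty); [apply is_lim_seq_INR|easy].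
Qed.

(** * Complex differentiation *)

Definition Cderiv (f : C -> C) (z l : C) : Prop :=
  forall eps, 0 < eps -> exists delta, 0 < delta /\
    forall h, Cmod h < delta ->
      Cmod (f (z + h) - f z - h * l)%C <= eps * Cmod h.

(** [C] carries two normed-module structures. This lemma targets the one used for [analytic_at];
    [Cderiv_iff] targets the one coming from the absolute ring, for which the product and chain
    rules are available. *)
Lemma Cderiv_is_derive (f : C -> C) (z l : C) :
  Cderiv f z l -> @is_derive C_AbsRing C_NormedModule f z l.
Proof.
intros H. split; [apply is_linear_scal_l|].
intros x Hx.
apply (is_filter_lim_locally_unique (V := AbsRing_NormedModule C_AbsRing)) in Hx.
subst x. intros eps.
destruct (H eps (cond_pos eps)) as [d [Hd H']].
exists (mkposreal d Hd). intros y Hy.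
specialize (H' (y - z)%C Hy).
assert (E : (z + (y - z))%C = y) by ring. rewrite E in H'. exact H'.
Qed.

Lemma Cderiv_iff (f : C -> C) (z l : C) :
  Cderiv f z l <-> @is_derive C_AbsRing (AbsRing_NormedModule C_AbsRing) f z l.
Proof.
split; intros H.
- split; [apply is_linear_scal_l|].
  intros x Hx.
  apply (is_filter_lim_locally_unique (V := AbsRing_NormedModule C_AbsRing)) in Hx.
  subst x. intros eps.
  destruct (H eps (cond_pos eps)) as [d [Hd H']].
  exists (mkposreal d Hd). intros y Hy.
  specialize (H' (y - z)%C Hy).
  assert (E : (z + (y - z))%C = y) by ring. rewrite E in H'. exact H'.
- intros eps Heps. destruct H as [_ H].
  specialize (H z (fun P HP => HP) (mkposreal eps Heps)).
  destruct H as [d H].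
  exists d. split; [apply cond_pos|]. intros h Hh.
  specialize (H (z + h)%C).
  assert (E : @minus (AbsRing_NormedModule C_AbsRing) (z + h)%C z = h).
  { unfold minus, plus, opp; simpl. ring. }
  rewrite E in H. apply H.
  unfold ball; simpl. unfold AbsRing_ball.
  change (Cmod (z + h - z)%C < d).
  now replace (z + h - z)%C with h by ring.
Qed.

Lemma Cderiv_ext_loc (f g : C -> C) (z l : C) (r : R) :
  0 < r -> (forall h, Cmod h < r -> f (z + h)%C = g (z + h)%C) ->
  Cderiv f z l -> Cderiv g z l.
Proof.
intros Hr E H eps Heps. destruct (H eps Heps) as [d [Hd H']].
exists (Rmin r d). split; [now apply Rmin_glb_lt|].
intros h Hh.
assert (E0 : f z = g z).
{ replace z with (z + 0)%C by ring. apply E. now rewrite Cmod_0. }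
rewrite <- E, <- E0.
- apply H'. eapply Rlt_le_trans; [exact Hh|apply Rmin_r].
- eapply Rlt_le_trans; [exact Hh|apply Rmin_l].
Qed.

Lemma Cderiv_ext (f g : C -> C) (z l : C) :
  (forall w, f w = g w) -> Cderiv f z l -> Cderiv g z l.
Proof. intros E. apply Cderiv_ext_loc with 1; [lra|now intros]. Qed.

Lemma Cderiv_quad (f : C -> C) (z l : C) (K r : R) :
  0 < r ->
  (forall h, Cmod h < r -> Cmod (f (z + h) - f z - h * l)%C <= K * Cmod h ^ 2) ->
  Cderiv f z l.
Proof.
intros Hr H eps Heps.
assert (HK : 0 < Rabs K + 1) by (pose proof (Rabs_pos K); lra).
(* Adding 1 to [Rabs K] keeps the divisor positive when [K] is zero. *)
exists (Rmin r (eps / (Rabs K + 1))). split.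
{ apply Rmin_glb_lt; [exact Hr|now apply Rdiv_lt_0_compat]. }
intros h Hh.
eapply Rle_trans.
{ apply H. eapply Rlt_le_trans; [exact Hh|apply Rmin_l]. }
assert (Hh2 : Cmod h <= eps / (Rabs K + 1)).
{ apply Rlt_le. eapply Rlt_le_trans; [exact Hh|apply Rmin_r]. }
pose proof (Cmod_ge_0 h).
replace (K * Cmod h ^ 2) with (K * Cmod h * Cmod h) by ring.
apply Rmult_le_compat_r; [easy|].
apply Rle_trans with ((Rabs K + 1) * Cmod h).
{ apply Rmult_le_compat_r; [easy|]. pose proof (Rle_abs K). lra. }
rewrite Rmult_comm. apply Rle_div_r; [easy|exact Hh2].
Qed.

Lemma Cderiv_const (a z : C) : Cderiv (fun _ => a) z 0.
Proof. apply Cderiv_iff. apply (is_derive_const (V := AbsRing_NormedModule C_AbsRing)). Qed.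

Lemma Cderiv_id (z : C) : Cderiv (fun w => w) z 1.
Proof. apply Cderiv_iff. exact (is_derive_id (K := C_AbsRing) z). Qed.

Lemma Cderiv_plus (f g : C -> C) (z l m : C) :
  Cderiv f z l -> Cderiv g z m -> Cderiv (fun w => f w + g w)%C z (l + m)%C.
Proof.
rewrite !Cderiv_iff. apply (is_derive_plus (V := AbsRing_NormedModule C_AbsRing)).
Qed.

Lemma Cderiv_mult (f g : C -> C) (z l m : C) :
  Cderiv f z l -> Cderiv g z m ->
  Cderiv (fun w => f w * g w)%C z (l * g z + f z * m)%C.
Proof.
rewrite !Cderiv_iff. intros H1 H2.
exact (is_derive_mult (K := C_AbsRing) f g z l m H1 H2 Cmult_comm).
Qed.

Lemma Cderiv_comp (f g : C -> C) (z l m : C) :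
  Cderiv f (g z) l -> Cderiv g z m -> Cderiv (fun w => f (g w)) z (m * l)%C.
Proof.
rewrite !Cderiv_iff.
apply (is_derive_comp (K := C_AbsRing) (V := AbsRing_NormedModule C_AbsRing)).
Qed.

Definition Cdifferentiable (f : C -> C) (z : C) : Prop := exists l, Cderiv f z l.

Lemma Cdiff_const (a z : C) : Cdifferentiable (fun _ => a) z.
Proof. eexists; apply Cderiv_const. Qed.

Lemma Cdiff_id (z : C) : Cdifferentiable (fun w => w) z.
Proof. eexists; apply Cderiv_id. Qed.

Lemma Cdiff_plus (f g : C -> C) (z : C) :
  Cdifferentiable f z -> Cdifferentiable g z ->
  Cdifferentiable (fun w => f w + g w)%C z.
Proof. intros [l H] [m H']. eexists. apply Cderiv_plus; eassumption. Qed.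

Lemma Cdiff_mult (f g : C -> C) (z : C) :
  Cdifferentiable f z -> Cdifferentiable g z ->
  Cdifferentiable (fun w => f w * g w)%C z.
Proof. intros [l H] [m H']. eexists. apply Cderiv_mult; eassumption. Qed.

Lemma Cdiff_comp (f g : C -> C) (z : C) :
  Cdifferentiable f (g z) -> Cdifferentiable g z ->
  Cdifferentiable (fun w => f (g w)) z.
Proof. intros [l H] [m H']. eexists. apply Cderiv_comp; eassumption. Qed.

Lemma Cdiff_ext (f g : C -> C) (z : C) :
  (forall w, f w = g w) -> Cdifferentiable f z -> Cdifferentiable g z.
Proof. intros E [l H]. exists l. now apply Cderiv_ext with f. Qed.

Lemma Cdiff_minus (f g : C -> C) (z : C) :
  Cdifferentiable f z -> Cdifferentiable g z ->
  Cdifferentiable (fun w => f w - g w)%C z.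
Proof.
intros H1 H2. apply Cdiff_ext with (fun w => f w + (-(1)) * g w)%C.
- intros w; ring.
- apply Cdiff_plus; [exact H1|]. apply Cdiff_mult; [apply Cdiff_const|exact H2].
Qed.

(** The remainder is exactly h^2 / (z^2 (z + h)), and |z + h| >= |z| / 2 when |h| < |z| / 2. *)
Lemma Cdiff_inv (z : C) : z <> 0%C -> Cdifferentiable Cinv z.
Proof.
intros Hz. pose proof (proj1 (Cmod_gt_0 z) Hz) as Hp.
exists (- / (z * z))%C.
apply Cderiv_quad with (K := 2 / Cmod z ^ 3) (r := Cmod z / 2); [lra|].
intros h Hh.
assert (Hzh : Cmod z / 2 <= Cmod (z + h)%C).
{ pose proof (Cmod_triangle (z + h) (- h)) as H.
  rewrite Cmod_opp in H. replace (z + h + - h)%C with z in H by ring. lra. }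
assert (Hn : (z + h)%C <> 0%C) by (apply Cmod_gt_0; lra).
replace (/ (z + h) - / z - h * - / (z * z))%C
  with (h * h * / (z * z * (z + h)))%C by (field; now split).
rewrite !Cmod_mult, Cmod_inv, !Cmod_mult; [|now repeat apply Cmult_neq_0].
replace (2 / Cmod z ^ 3 * Cmod h ^ 2)
  with (Cmod h * Cmod h * / (Cmod z * Cmod z * (Cmod z / 2))) by (field; lra).
apply Rmult_le_compat_l; [apply Rmult_le_pos; apply Cmod_ge_0|].
apply Rinv_le_contravar.
- repeat apply Rmult_lt_0_compat; lra.
- apply Rmult_le_compat_l; [apply Rmult_le_pos; lra|exact Hzh].
Qed.

Lemma Cdiff_lipschitz (f : C -> C) (z : C) :
  Cdifferentiable f z -> exists K r, 0 < K /\ 0 < r /\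
    forall h, Cmod h < r -> Cmod (f (z + h) - f z)%C <= K * Cmod h.
Proof.
intros [l H]. destruct (H 1 Rlt_0_1) as [d [Hd H']].
exists (Cmod l + 1), d. pose proof (Cmod_ge_0 l).
split; [lra|]. split; [easy|]. intros h Hh.
replace (f (z + h) - f z)%C with (f (z + h) - f z - h * l + h * l)%C by ring.
eapply Rle_trans; [apply Cmod_triangle|]. rewrite Cmod_mult.
specialize (H' h Hh). lra.
Qed.

(** Small real increments t > 0 suffice: if M < |l|, taking eps = (|l| - M) / 2 gives t |l| <= t
    (|l| + M) / 2, which is absurd. *)
Lemma Cderiv_le (f : C -> C) (z l : C) (M r : R) :
  Cderiv f z l -> 0 < r ->
  (forall h, Cmod h < r -> Cmod (f (z + h) - f z)%C <= M * Cmod h) ->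
  Cmod l <= M.
Proof.
intros H Hr HM. apply Rnot_lt_le. intros Hlt.
destruct (H ((Cmod l - M) / 2)) as [d [Hd H']]; [lra|].
set (t := Rmin d r / 2).
assert (Ht : 0 < t < d /\ t < r).
{ pose proof (Rmin_l d r). pose proof (Rmin_r d r).
  assert (0 < Rmin d r) by (now apply Rmin_glb_lt). unfold t. lra. }
assert (Em : Cmod (RtoC t) = t) by (rewrite Cmod_R; apply Rabs_pos_eq; lra).
specialize (H' (RtoC t)). specialize (HM (RtoC t)). rewrite Em in *.
specialize (H' ltac:(lra)). specialize (HM ltac:(lra)).
assert (Hc : Cmod (RtoC t * l)%C <= (Cmod l - M) / 2 * t + M * t).
{ replace (RtoC t * l)%C with
    ((f (z + t) - f z) + - (f (z + t) - f z - t * l))%C by ring.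
  eapply Rle_trans; [apply Cmod_triangle|]. rewrite Cmod_opp. lra. }
rewrite Cmod_mult, Em in Hc.
assert (t * Cmod l <= t * ((Cmod l + M) / 2)) as Hc' by lra.
apply Rmult_le_reg_l in Hc'; lra.
Qed.

Lemma Cderiv_Cpsum (f : nat -> C -> C) (z : C) (l : nat -> C) (n : nat) :
  (forall k, (k <= n)%nat -> Cderiv (f k) z (l k)) ->
  Cderiv (fun w => Cpsum (fun k => f k w) n) z (Cpsum l n).
Proof.
induction n as [|n IH]; intros H; simpl; [apply H; lia|].
apply Cderiv_plus; [apply IH; intros; apply H; lia|apply H; lia].
Qed.

Lemma Cdiff_Cpsum (f : nat -> C -> C) (z : C) (n : nat) :
  (forall k, (k <= n)%nat -> Cdifferentiable (f k) z) ->
  Cdifferentiable (fun w => Cpsum (fun k => f k w) n) z.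
Proof.
induction n as [|n IH]; intros H; simpl; [apply H; lia|].
apply Cdiff_plus; [apply IH; intros; apply H; lia|apply H; lia].
Qed.

(* Tannery's argument: the summable Lipschitz bounds at the fixed point [z]
   dominate the difference quotients, so no second derivative is needed. *)
Lemma Cdiff_series (f : nat -> C -> C) (F : C -> C) (z : C) (M : nat -> R) (r : R) :
  0 < r -> ex_series M ->
  (forall n, Cdifferentiable (f n) z) ->
  (forall n h, Cmod h < r -> Cmod (f n (z + h) - f n z)%C <= M n * Cmod h) ->
  (forall h, Cmod h < r -> Ccv (Cpsum (fun n => f n (z + h)%C)) (F (z + h)%C)) ->
  Cdifferentiable F z.
Proof.
intros Hr [SM HM] Hd HL HF.
set (l n := proj1_sig (constructive_indefinite_description _ (Hd n))).
assert (Hl : forall n, Cderiv (f n) z (l n)).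
{ intros n. exact (proj2_sig (constructive_indefinite_description _ (Hd n))). }
clearbody l.
assert (Hlb : forall n, Cmod (l n) <= M n).
{ intros n. apply Cderiv_le with (1 := Hl n) (2 := Hr). apply HL. }
assert (HL0 : Ccv (Cpsum l) (Csum l)).
{ apply Csum_cv with M; [exact Hlb|now exists SM]. }
assert (HM0 : forall n, 0 <= M n).
{ intros n. eapply Rle_trans; [apply Cmod_ge_0|apply Hlb]. }
assert (HF0 : Ccv (Cpsum (fun n => f n z)) (F z)).
{ replace z with (z + 0)%C by ring. apply HF. now rewrite Cmod_0. }
exists (Csum l). intros eps Heps.
(* The tail will contribute 2 (2 |h| eps / 8) = |h| eps / 2: one 2 comes from [Ccv_Cmod_le], the
   other from the bound 2 |h| M n on the terms. The first terms, up to [K], take the remaining half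
   of eps. *)
assert (HK : exists K, forall n, (K <= n)%nat -> sum_n M n - sum_n M K <= eps / 8).
{ apply (is_lim_seq_spec (sum_n M) SM) in HM.
  destruct (HM (mkposreal (eps / 16) ltac:(lra))) as [K HK]. simpl in HK.
  exists K. intros n Hn.
  pose proof (HK K (le_n _)) as H1. pose proof (HK n Hn) as H2.
  apply Rabs_def2 in H1. apply Rabs_def2 in H2. lra. }
destruct HK as [K HK].
destruct (Cderiv_Cpsum f z l K (fun k _ => Hl k) (eps / 2) ltac:(lra))
  as [d [Hd0 Hd1]].
exists (Rmin r d). split; [now apply Rmin_glb_lt|]. intros h Hh.
pose proof (Rmin_l r d). pose proof (Rmin_r r d). pose proof (Cmod_ge_0 h).
specialize (Hd1 h ltac:(lra)).
set (v := fun n => (f n (z + h) - f n z - h * l n)%C).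
assert (Ev : forall n, Cpsum v n = (Cpsum (fun k => f k (z + h)) n
  - Cpsum (fun k => f k z) n - h * Cpsum l n)%C).
{ intros n. unfold v.
  rewrite (Cpsum_minus (fun k => f k (z + h) - f k z)%C), Cpsum_minus, Cpsum_scal.
  reflexivity. }
assert (Hv : Ccv (Cpsum v) (F (z + h) - F z - h * Csum l)%C).
{ eapply Ccv_ext; [intros n; symmetry; apply Ev|].
  apply Ccv_minus; [apply Ccv_minus; [apply HF; lra|exact HF0]|].
  now apply Ccv_scal. }
assert (Hvb : forall n, Cmod (v n) <= 2 * Cmod h * M n).
{ intros n. unfold v.
  replace (f n (z + h) - f n z - h * l n)%C
    with (f n (z + h) - f n z + - (h * l n))%C by ring.
  eapply Rle_trans; [apply Cmod_triangle|]. rewrite Cmod_opp, Cmod_mult.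
  pose proof (HL n h ltac:(lra)).
  pose proof (Rmult_le_compat_l _ _ _ (Cmod_ge_0 h) (Hlb n)). lra. }
assert (Ht : Cmod (F (z + h) - F z - h * Csum l - Cpsum v K)%C
             <= 2 * (2 * Cmod h * (eps / 8))).
{ apply Ccv_Cmod_le with (1 := Hv) (N := K). intros n Hn.
  eapply Rle_trans; [apply Cpsum_tail_bound with (1 := Hvb); exact Hn|].
  assert (Es : forall m, sum_n (fun k => 2 * Cmod h * M k) m
               = 2 * Cmod h * sum_n M m).
  { intros m. exact (sum_n_mult_l (K := R_Ring) (2 * Cmod h) M m). }
  rewrite !Es, <- Rmult_minus_distr_l.
  apply Rmult_le_compat_l; [lra|now apply HK]. }
rewrite <- Ev in Hd1.
replace (F (z + h) - F z - h * Csum l)%C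
  with ((F (z + h) - F z - h * Csum l - Cpsum v K) + Cpsum v K)%C by ring.
eapply Rle_trans; [apply Cmod_triangle|]. lra.
Qed.

(** * Complex-valued functions of a real variable and the exponential *)

Definition CRderiv (f : R -> C) (x : R) (l : C) : Prop :=
  is_derive (fun t => Re (f t)) x (Re l) /\ is_derive (fun t => Im (f t)) x (Im l).

Lemma CRderiv_ext (f g : R -> C) (x : R) (l : C) :
  (forall t, f t = g t) -> CRderiv f x l -> CRderiv g x l.
Proof.
intros E [H1 H2]; split.
- apply is_derive_ext with (2 := H1). intros t; now rewrite E.
- apply is_derive_ext with (2 := H2). intros t; now rewrite E.
Qed.

Lemma CRderiv_const (a : C) (x : R) : CRderiv (fun _ => a) x 0.
Proof.
split; exact (is_derive_const (K := R_AbsRing) (V := R_NormedModule) _ x).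
Qed.

Lemma CRderiv_RtoC (f : R -> R) (x l : R) :
  is_derive f x l -> CRderiv (fun t => RtoC (f t)) x (RtoC l).
Proof.
intros H. split; [exact H|].
exact (is_derive_const (K := R_AbsRing) (V := R_NormedModule) 0 x).
Qed.

Lemma CRderiv_plus (f g : R -> C) (x : R) (l m : C) :
  CRderiv f x l -> CRderiv g x m -> CRderiv (fun t => f t + g t)%C x (l + m)%C.
Proof.
intros [H1 H2] [H3 H4]. split; simpl.
- exact (is_derive_plus (K := R_AbsRing) (V := R_NormedModule) _ _ _ _ _ H1 H3).
- exact (is_derive_plus (K := R_AbsRing) (V := R_NormedModule) _ _ _ _ _ H2 H4).
Qed.

Lemma is_derive_value_eq (f : R -> R) (x l m : R) :
  is_derive f x l -> l = m -> is_derive f x m.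
Proof. now intros H <-. Qed.

Lemma CRderiv_mult (f g : R -> C) (x : R) (l m : C) :
  CRderiv f x l -> CRderiv g x m ->
  CRderiv (fun t => f t * g t)%C x (l * g x + f x * m)%C.
Proof.
intros [H1 H2] [H3 H4]. split; simpl.
- eapply is_derive_value_eq.
  + apply (is_derive_minus (K := R_AbsRing) (V := R_NormedModule));
      apply Derive.is_derive_mult; eassumption.
  + unfold minus, plus, opp; simpl. unfold Re, Im. ring.
- eapply is_derive_value_eq.
  + apply (is_derive_plus (K := R_AbsRing) (V := R_NormedModule));
      apply Derive.is_derive_mult; eassumption.
  + unfold plus; simpl. unfold Re, Im. ring.
Qed.

Lemma CRderiv_scal (a : C) (f : R -> C) (x : R) (l : C) :
  CRderiv f x l -> CRderiv (fun t => a * f t)%C x (a * l)%C.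
Proof.
intros H. replace (a * l)%C with (0 * f x + a * l)%C by ring.
apply CRderiv_mult; [apply CRderiv_const|exact H].
Qed.

Lemma CRderiv_comp (f : R -> C) (g : R -> R) (x dg : R) (l : C) :
  CRderiv f (g x) l -> is_derive g x dg ->
  CRderiv (fun t => f (g t)) x (RtoC dg * l)%C.
Proof.
intros [H1 H2] Hg. split; simpl.
- replace (dg * fst l - 0 * snd l) with (dg * Re l) by (unfold Re; ring).
  exact (is_derive_comp (K := R_AbsRing) (V := R_NormedModule)
           (fun t => Re (f t)) g x _ _ H1 Hg).
- replace (dg * snd l + 0 * fst l) with (dg * Im l) by (unfold Im; ring).
  exact (is_derive_comp (K := R_AbsRing) (V := R_NormedModule)
           (fun t => Im (f t)) g x _ _ H2 Hg).
Qed.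

Lemma is_derive_bound_01 (f df : R -> R) (D : R) :
  (forall t, 0 <= t <= 1 -> is_derive f t (df t) /\ Rabs (df t) <= D) ->
  Rabs (f 1 - f 0) <= D.
Proof.
intros H.
destruct (MVT_gen f 0 1 df) as [c [Hc E]].
- intros x. rewrite Rmin_left, Rmax_right by lra. intros Hx. apply H; lra.
- intros x. rewrite Rmin_left, Rmax_right by lra. intros Hx.
  apply continuity_pt_filterlim.
  apply (ex_derive_continuous (V := R_NormedModule)). exists (df x). now apply H.
- rewrite Rmin_left, Rmax_right in Hc by lra.
  rewrite E, Rminus_0_r, Rmult_1_r. now apply H.
Qed.

(** The mean value theorem fails for complex values, so it is applied to each coordinate, at the
    cost of a factor 2. *)
Lemma CRderiv_bound_01 (f df : R -> C) (D : R) :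
  (forall t, 0 <= t <= 1 -> CRderiv f t (df t) /\ Cmod (df t) <= D) ->
  Cmod (f 1 - f 0)%C <= 2 * D.
Proof.
intros H. eapply Rle_trans; [apply Cmod_le_Re_Im|].
enough (Rabs (Re (f 1 - f 0)%C) <= D /\ Rabs (Im (f 1 - f 0)%C) <= D) by lra.
split; simpl.
- apply (is_derive_bound_01 (fun t => Re (f t)) (fun t => Re (df t))). intros t Ht.
  destruct (H t Ht) as [[H1 _] H2]. split; [exact H1|].
  eapply Rle_trans; [apply Re_le_Cmod|exact H2].
- apply (is_derive_bound_01 (fun t => Im (f t)) (fun t => Im (df t))). intros t Ht.
  destruct (H t Ht) as [[_ H1] H2]. split; [exact H1|].
  eapply Rle_trans; [apply Im_le_Cmod|exact H2].
Qed.

(** * The complex exponential and its Taylor remainders *)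

Lemma Cexp_plus (a b : C) : Cexp (a + b) = (Cexp a * Cexp b)%C.
Proof.
unfold Cexp, Cmult, Cplus, Re, Im; simpl.
rewrite exp_plus, cos_plus, sin_plus. f_equal; ring.
Qed.

Lemma Cexp_RtoC (x : R) : Cexp (RtoC x) = RtoC (exp x).
Proof.
unfold Cexp, RtoC; simpl. rewrite cos_0, sin_0. f_equal; ring.
Qed.

Lemma Cexp_0 : Cexp 0 = 1%C.
Proof. now rewrite Cexp_RtoC, exp_0. Qed.

Lemma Cmod_Cexp (z : C) : Cmod (Cexp z) = exp (Re z).
Proof.
unfold Cmod, Cexp; simpl.
replace (exp (Re z) * cos (Im z) * (exp (Re z) * cos (Im z) * 1) +
   exp (Re z) * sin (Im z) * (exp (Re z) * sin (Im z) * 1))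
  with (exp (Re z) ^ 2 * (Rsqr (sin (Im z)) + Rsqr (cos (Im z))))
  by (unfold Rsqr; ring).
rewrite sin2_cos2, Rmult_1_r. apply sqrt_pow2, Rlt_le, exp_pos.
Qed.

Lemma CRderiv_Cexp (w : C) (t : R) :
  CRderiv (fun t => Cexp (w * RtoC t)) t (w * Cexp (w * RtoC t))%C.
Proof.
destruct w as [a b]. unfold CRderiv, Cexp; simpl. unfold Re, Im; simpl.
split; auto_derive; try easy; unfold Rminus; ring.
Qed.

Lemma exp_le_mono (x y : R) : x <= y -> exp x <= exp y.
Proof. intros [H| ->]; [left; now apply exp_increasing|right; reflexivity]. Qed.

Lemma Cexp_ray_bound (w : C) (t : R) :
  0 <= t <= 1 -> Cmod (Cexp (w * RtoC t)) <= exp (Cmod w).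
Proof.
intros Ht. rewrite Cmod_Cexp. apply exp_le_mono.
replace (Re (w * RtoC t)) with (Re w * t) by (simpl; unfold Re; ring).
pose proof (Rle_abs (Re w)). pose proof (Re_le_Cmod w).
apply Rle_trans with (Cmod w * t).
- apply Rmult_le_compat_r; lra.
- pose proof (Cmod_ge_0 w). nra.
Qed.

Lemma Cmod_ray_le (w : C) (t : R) :
  0 <= t <= 1 -> Cmod (w * RtoC t) <= Cmod w.
Proof.
intros Ht. rewrite Cmod_mult, Cmod_R, Rabs_pos_eq by lra.
pose proof (Cmod_ge_0 w). nra.
Qed.

Lemma CRderiv_eq (f : R -> C) (x : R) (l m : C) :
  CRderiv f x l -> l = m -> CRderiv f x m.
Proof. now intros H <-. Qed.

(** The three Taylor bounds follow one from another. Along the ray from 0 to w, each remainder has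
    as t-derivative w times the previous remainder at wt, so [CRderiv_bound_01] yields one more
    power of |w| and one more factor 2. *)
Lemma Cexp_taylor0 (w : C) :
  Cmod (Cexp w - 1) <= 2 * (Cmod w * exp (Cmod w)).
Proof.
pose proof (CRderiv_bound_01 (fun t => Cexp (w * RtoC t))
  (fun t => w * Cexp (w * RtoC t))%C (Cmod w * exp (Cmod w))) as H.
cbv beta in H.
rewrite Cmult_1_r, Cmult_0_r, Cexp_0 in H. apply H.
intros t Ht. split; [apply CRderiv_Cexp|].
rewrite Cmod_mult. apply Rmult_le_compat_l; [apply Cmod_ge_0|].
now apply Cexp_ray_bound.
Qed.

Lemma Cexp_taylor1 (w : C) :
  Cmod (Cexp w - 1 - w) <= 4 * (Cmod w ^ 2 * exp (Cmod w)).
Proof.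
pose proof (CRderiv_bound_01 (fun t => Cexp (w * RtoC t) + (- w) * RtoC t)%C
  (fun t => w * (Cexp (w * RtoC t) - 1))%C
  (2 * (Cmod w ^ 2 * exp (Cmod w)))) as H.
cbv beta in H.
rewrite !Cmult_1_r, !Cmult_0_r, Cexp_0 in H.
replace (Cexp w - 1 - w)%C with (Cexp w + - w - (1 + 0))%C by ring.
eapply Rle_trans; [apply H|right; ring].
intros t Ht. split.
- eapply CRderiv_eq.
  + apply CRderiv_plus; [apply CRderiv_Cexp|].
    apply CRderiv_scal, CRderiv_RtoC, (is_derive_id (K := R_AbsRing)).
  + change (@one R_AbsRing) with 1. ring.
- rewrite Cmod_mult.
  replace (2 * (Cmod w ^ 2 * exp (Cmod w)))
    with (Cmod w * (2 * (Cmod w * exp (Cmod w)))) by ring.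
  apply Rmult_le_compat_l; [apply Cmod_ge_0|].
  eapply Rle_trans; [apply Cexp_taylor0|].
  pose proof (Cmod_ray_le w t Ht).
  apply Rmult_le_compat_l; [lra|].
  apply Rmult_le_compat; [apply Cmod_ge_0|apply Rlt_le, exp_pos|easy|].
  now apply exp_le_mono.
Qed.

Lemma Cexp_taylor2 (w : C) :
  Cmod (Cexp w - 1 - w - w * w / 2) <= 8 * (Cmod w ^ 3 * exp (Cmod w)).
Proof.
pose proof (CRderiv_bound_01
  (fun t => Cexp (w * RtoC t) + (- w) * RtoC t + (- w * w) * RtoC (t ^ 2 / 2))%C
  (fun t => w * (Cexp (w * RtoC t) - 1 - w * RtoC t))%C
  (4 * (Cmod w ^ 3 * exp (Cmod w)))) as H.
cbv beta in H.
replace (1 ^ 2 / 2) with (/ 2) in H by field.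
replace (0 ^ 2 / 2) with 0 in H by field.
rewrite !Cmult_1_r, !Cmult_0_r, Cexp_0, RtoC_inv in H by lra.
replace (Cexp w - 1 - w - w * w / 2)%C
  with (Cexp w + - w + - w * w * / 2 - (1 + 0 + 0))%C
  by (unfold Cdiv; ring).
eapply Rle_trans; [apply H|right; ring].
intros t Ht. split.
- eapply CRderiv_eq.
  + apply CRderiv_plus; [apply CRderiv_plus; [apply CRderiv_Cexp|]|].
    * apply CRderiv_scal, CRderiv_RtoC, (is_derive_id (K := R_AbsRing)).
    * apply CRderiv_scal, CRderiv_RtoC.
      apply is_derive_value_eq with (m := t) (l := 2 * t / 2); [|field].
      auto_derive; [easy|field].
  + change (@one R_AbsRing) with 1. ring.
- rewrite Cmod_mult.
  replace (4 * (Cmod w ^ 3 * exp (Cmod w)))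
    with (Cmod w * (4 * (Cmod w ^ 2 * exp (Cmod w)))) by ring.
  apply Rmult_le_compat_l; [apply Cmod_ge_0|].
  eapply Rle_trans; [apply Cexp_taylor1|].
  pose proof (Cmod_ray_le w t Ht).
  apply Rmult_le_compat_l; [lra|].
  apply Rmult_le_compat; [apply pow_le, Cmod_ge_0|apply Rlt_le, exp_pos| |].
  + apply pow_incr. split; [apply Cmod_ge_0|easy].
  + now apply exp_le_mono.
Qed.

Lemma Cdiff_Cexp (z : C) : Cdifferentiable Cexp z.
Proof.
exists (Cexp z).
apply Cderiv_quad with (K := Cmod (Cexp z) * (4 * exp 1)) (r := 1); [lra|].
intros h Hh. rewrite Cexp_plus.
replace (Cexp z * Cexp h - Cexp z - h * Cexp z)%C
  with (Cexp z * (Cexp h - 1 - h))%C by ring.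
rewrite Cmod_mult, Rmult_assoc.
apply Rmult_le_compat_l; [apply Cmod_ge_0|].
eapply Rle_trans; [apply Cexp_taylor1|].
rewrite Rmult_assoc. apply Rmult_le_compat_l; [lra|].
rewrite Rmult_comm. apply Rmult_le_compat_r; [apply pow_le, Cmod_ge_0|].
apply exp_le_mono. lra.
Qed.

(* The removable singularity of [(e^w - 1) / w] is filled in, so that the
   antiderivative in [x] of [x ^ (- s)] below is entire in [s], also at [s = 1]. *)
Definition Cexpq (w : C) : C :=
  if Ceq_dec w 0 then 1%C else ((Cexp w - 1) / w)%C.

Lemma Cexpq_0 : Cexpq 0 = 1%C.
Proof. unfold Cexpq. now destruct (Ceq_dec 0 0). Qed.

Lemma Cexpq_mult (w : C) : (w * Cexpq w)%C = (Cexp w - 1)%C.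
Proof.
unfold Cexpq. destruct (Ceq_dec w 0) as [->|H].
- rewrite Cexp_0. ring.
- field. exact H.
Qed.

Lemma Cdiff_Cexpq (z : C) : Cdifferentiable Cexpq z.
Proof.
destruct (Ceq_dec z 0) as [->|Hz].
(* The expansion (e^h - 1) / h = 1 + h / 2 + O(h^2) gives the derivative at 0; its error is
   [Cexp_taylor2] divided by |h|. *)
- exists (/ 2)%C.
  apply Cderiv_quad with (K := 8 * exp 1) (r := 1); [lra|].
  intros h Hh. rewrite Cexpq_0, Cplus_0_l.
  destruct (Ceq_dec h 0) as [->|Hh0].
  { rewrite Cexpq_0. replace (1 - 1 - 0 * / 2)%C with (RtoC 0) by ring.
    rewrite Cmod_0. right; ring. }
  pose proof (proj1 (Cmod_gt_0 h) Hh0) as Hp.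
  apply Rmult_le_reg_l with (Cmod h); [exact Hp|].
  rewrite <- Cmod_mult.
  replace (h * (Cexpq h - 1 - h * / 2))%C
    with (Cexp h - 1 - h - h * h / 2)%C
    by (rewrite <- Cexpq_mult; unfold Cdiv; ring).
  eapply Rle_trans; [apply Cexp_taylor2|].
  assert (exp (Cmod h) <= exp 1) by (apply exp_le_mono; lra).
  pose proof (pow_lt _ 3 Hp).
  replace (Cmod h * (8 * exp 1 * Cmod h ^ 2)) with (8 * (Cmod h ^ 3 * exp 1)) by ring.
  apply Rmult_le_compat_l; [lra|]. apply Rmult_le_compat_l; lra.
- assert (H : Cdifferentiable (fun w => (Cexp w - 1) * / w)%C z).
  { apply Cdiff_mult; [|now apply Cdiff_inv].
    apply Cdiff_minus; [apply Cdiff_Cexp|apply Cdiff_const]. }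
  destruct H as [l H]. exists l.
  apply Cderiv_ext_loc with (r := Cmod z) (3 := H).
  + now apply Cmod_gt_0.
  + intros h Hh. unfold Cexpq. destruct (Ceq_dec (z + h) 0) as [E|E]; [|easy].
    exfalso. assert (Ez : z = (- h)%C)
      by (replace z with (z + h - h)%C by ring; rewrite E; ring).
    rewrite Ez, Cmod_opp in Hh. lra.
Qed.

(** * Bernoulli polynomials and the Euler-Maclaurin remainder *)

(* [bern_poly n t] is the Bernoulli polynomial [B_n(t) / n!]. *)
Definition bern_poly (n : nat) (t : R) : R :=
  sum_f_R0 (fun i => bern_coef i * (t ^ (n - i) / INR (fact (n - i)))) n.

Lemma is_derive_sum_f_R0 (f : nat -> R -> R) (d : nat -> R) (n : nat) (x : R) :
  (forall k, (k <= n)%nat -> is_derive (f k) x (d k)) ->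
  is_derive (fun t => sum_f_R0 (fun k => f k t) n) x (sum_f_R0 d n).
Proof.
induction n as [|n IH]; intros H; simpl; [apply H; lia|].
apply (is_derive_plus (K := R_AbsRing) (V := R_NormedModule)).
- apply IH; intros; apply H; lia.
- apply H; lia.
Qed.

Lemma is_derive_bern_poly (n : nat) (t : R) :
  is_derive (bern_poly (S n)) t (bern_poly n t).
Proof.
unfold bern_poly at 1. simpl sum_f_R0.
rewrite <- (Rplus_0_r (bern_poly n t)).
apply (is_derive_plus (K := R_AbsRing) (V := R_NormedModule)).
- apply (is_derive_sum_f_R0
    (fun i t => bern_coef i * (t ^ (S n - i) / INR (fact (S n - i))))).
  intros k Hk. apply is_derive_scal.
  replace (S n - k)%nat with (S (n - k)) by lia.
  eapply is_derive_value_eq.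
  + apply (is_derive_ext (fun t => / INR (fact (S (n - k))) * t ^ S (n - k))).
    { intros u. apply Rmult_comm. }
    apply is_derive_scal, is_derive_pow, (is_derive_id (K := R_AbsRing)).
  + change (@one R_AbsRing) with 1.
    rewrite fact_simpl, mult_INR. simpl Nat.pred. field.
    split; [apply INR_fact_neq_0|apply not_0_INR; lia].
- rewrite Nat.sub_diag. simpl pow.
  exact (is_derive_const (K := R_AbsRing) (V := R_NormedModule) _ t).
Qed.

Lemma bern_poly_0 (t : R) : bern_poly 0 t = 1.
Proof. unfold bern_poly, bern_coef; simpl. field. Qed.

Lemma bern_poly_at_0 (n : nat) : bern_poly n 0 = bern_coef n.
Proof.
unfold bern_poly. destruct n as [|n]; [simpl; field|].
rewrite tech5, Nat.sub_diag.
rewrite (sum_eq _ (fun _ => 0)).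
- rewrite sum_cte. simpl. field.
- intros i Hi. replace (S n - i)%nat with (S (n - i)) by lia.
  rewrite pow_i by lia. unfold Rdiv. ring.
Qed.

(** This is the coefficient of x^(n + 2) in (e^x - 1) times the series of the b_i, a product equal
    to x. *)
Lemma bern_coef_sum (n : nat) :
  sum_f_R0 (fun i => bern_coef i * / INR (fact (S (S n) - i))) (S n) = 0.
Proof.
rewrite tech5, bern_coef_S.
replace (INR (fact (S (S n) - S n))) with 1
  by (now replace (S (S n) - S n)%nat with 1%nat by lia).
rewrite Rinv_1.
rewrite (sum_eq (fun i => bern_coef i * / INR (fact (S (S n) - i)))
  (fun j => bern_coef j * / INR (fact (S (S n - j))))); [ring|].
intros i Hi. now replace (S (S n) - i)%nat with (S (S n - i)) by lia.
Qed.

Lemma bern_coef_0 : bern_coef 0 = 1.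
Proof. reflexivity. Qed.

Lemma bern_coef_1 : bern_coef 1 = - / 2.
Proof. unfold bern_coef; simpl. field. Qed.

(** From degree 2 on, the values at 0 and 1 agree. In degree 1 they differ by 1
    ([bern_poly_1_at_1]), and this jump produces the summand (x + 1)^(-s) in [em_rest]. *)
Lemma bern_poly_at_1 (n : nat) :
  bern_poly (S (S n)) 1 = bern_coef (S (S n)).
Proof.
unfold bern_poly. rewrite tech5, Nat.sub_diag.
rewrite (sum_eq _ (fun i => bern_coef i * / INR (fact (S (S n) - i)))).
- rewrite bern_coef_sum. simpl. field.
- intros i Hi. rewrite pow1. unfold Rdiv. ring.
Qed.

Lemma bern_poly_1_at_1 : bern_poly 1 1 = bern_coef 1 + 1.
Proof. unfold bern_poly. simpl. rewrite bern_coef_0, bern_coef_1. field. Qed.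

Lemma bern_poly_bound (n : nat) (t : R) :
  0 <= t <= 1 -> Rabs (bern_poly n t) <= INR (S n).
Proof.
intros Ht. unfold bern_poly.
eapply Rle_trans; [apply Rsum_abs|].
rewrite <- (Rmult_1_l (INR (S n))), <- sum_cte.
apply sum_Rle. intros k Hk.
rewrite Rabs_mult. rewrite <- (Rmult_1_l 1).
apply Rmult_le_compat; try apply Rabs_pos; [apply bern_coef_bound|].
assert (H0 : 0 <= t ^ (n - k) <= 1).
{ split; [apply pow_le; lra|]. rewrite <- (pow1 (n - k)). apply pow_incr; lra. }
rewrite Rabs_pos_eq.
- apply Rle_div_l; [apply INR_fact_lt_0|].
  pose proof (le_INR _ _ (lt_O_fact (n - k))). simpl in H. lra.
- apply Rmult_le_pos; [apply H0|apply Rlt_le, inv_fact_pos].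
Qed.

(** * Complex powers of a positive real and the summation formula *)

Definition RCpow (x : R) (a : C) : C := Cexp (a * RtoC (ln x))%C.

Lemma Cmod_RCpow (x : R) (a : C) : Cmod (RCpow x a) = Rpower x (Re a).
Proof.
unfold RCpow. rewrite Cmod_Cexp. unfold Rpower. f_equal.
simpl. unfold Re. ring.
Qed.

Lemma RCpow_plus (x : R) (a b : C) : RCpow x (a + b) = (RCpow x a * RCpow x b)%C.
Proof. unfold RCpow. rewrite <- Cexp_plus. f_equal. ring. Qed.

Lemma RCpow_1_l (a : C) : RCpow 1 a = 1%C.
Proof. unfold RCpow. now rewrite ln_1, Cmult_0_r, Cexp_0. Qed.

Lemma RCpow_opp_1 (x : R) : 0 < x -> RCpow x (-(1)) = RtoC (/ x).
Proof.
intros Hx. unfold RCpow.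
replace (-(1) * RtoC (ln x))%C with (RtoC (- ln x)) by (rewrite RtoC_opp; ring).
now rewrite Cexp_RtoC, exp_Ropp, exp_ln.
Qed.

Lemma CRderiv_RCpow (a : C) (x : R) :
  0 < x -> CRderiv (fun t => RCpow t a) x (a * RCpow x (a - 1))%C.
Proof.
intros Hx. eapply CRderiv_eq.
- apply (CRderiv_comp (fun u => Cexp (a * RtoC u)) ln x (/ x)).
  + apply CRderiv_Cexp.
  + apply is_derive_Reals. now apply derivable_pt_lim_ln.
- unfold Cminus. rewrite RCpow_plus, RCpow_opp_1 by exact Hx. unfold RCpow. ring.
Qed.

(** The rising factorial s (s + 1) ... (s + n - 1). *)
Fixpoint Cpoch (n : nat) (s : C) : C :=
  match n with O => 1%C | S m => (Cpoch m s * (s + RtoC (INR m)))%C end.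

(* [pow_chain (S j) s] is [(-1)^j] times the [j]-th derivative of [x ^ (- s)],
   and [pow_chain 0 s] is minus its antiderivative [(x ^ (1 - s) - 1) / (1 - s)]. *)
Definition pow_chain (j : nat) (s : C) (x : R) : C :=
  match j with
  | O => (- (RtoC (ln x) * Cexpq ((1 - s) * RtoC (ln x))))%C
  | S m => (Cpoch m s * RCpow x (- s - RtoC (INR m)))%C
  end.

Lemma pow_chain_0_eq (s : C) (x : R) :
  s <> 1%C -> pow_chain 0 s x = ((1 - RCpow x (1 - s)) / (1 - s))%C.
Proof.
intros Hs.
assert (H : (1 - s)%C <> 0%C).
{ intros H. apply Hs. replace s with (1 - (1 - s))%C by ring. rewrite H. ring. }
unfold pow_chain, RCpow.
replace (1 - Cexp ((1 - s) * RtoC (ln x)))%C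
  with (- (Cexp ((1 - s) * RtoC (ln x)) - 1))%C by ring.
rewrite <- Cexpq_mult. field. exact H.
Qed.

Lemma CRderiv_pow_chain (j : nat) (s : C) (x : R) :
  0 < x -> CRderiv (pow_chain j s) x (- pow_chain (S j) s x)%C.
Proof.
intros Hx. destruct j as [|m].
(* At s = 1 the function is - ln x; for other s it is (1 - x^(1 - s)) / (1 - s). *)
- destruct (Ceq_dec s 1) as [->|Hs].
  + apply CRderiv_ext with (fun t => (-(1)) * RtoC (ln t))%C.
    { intros t. simpl. replace ((1 - 1) * RtoC (ln t))%C with (RtoC 0) by ring.
      rewrite Cexpq_0. ring. }
    eapply CRderiv_eq.
    * apply CRderiv_scal, CRderiv_RtoC.
      apply is_derive_Reals. now apply derivable_pt_lim_ln.
    * simpl. replace (- (1) - 0)%C with (- (1))%C by ring.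
      rewrite RCpow_opp_1 by exact Hx. ring.
  + assert (H : (1 - s)%C <> 0%C).
    { intros H. apply Hs. replace s with (1 - (1 - s))%C by ring. rewrite H. ring. }
    apply CRderiv_ext with (fun t => / (1 - s) + (- / (1 - s)) * RCpow t (1 - s))%C.
    { intros t. rewrite pow_chain_0_eq by exact Hs. field. exact H. }
    eapply CRderiv_eq.
    * apply CRderiv_plus; [apply CRderiv_const|].
      apply CRderiv_scal. now apply CRderiv_RCpow.
    * simpl. replace (1 - s - 1)%C with (- s - 0)%C by ring. field. exact H.
- eapply CRderiv_eq.
  + simpl. apply CRderiv_scal. now apply CRderiv_RCpow.
  + simpl Cpoch. unfold pow_chain. rewrite S_INR, RtoC_plus. simpl Cpoch.
    replace (- s - (RtoC (INR m) + 1))%C with (- s - RtoC (INR m) - 1)%C by ring.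
    ring.
Qed.

Lemma CRderiv_shift (f : R -> C) (c t : R) (l : C) :
  CRderiv f (c + t) l -> CRderiv (fun u => f (c + u)) t l.
Proof.
intros H. eapply CRderiv_eq.
- apply (CRderiv_comp f (fun u => c + u) t 1).
  + exact H.
  + auto_derive; [easy|ring].
- ring.
Qed.

(** The derivative of P_j F_j is P_(j-1) F_j - P_j F_(j+1), and the sum over j telescopes. *)
Lemma CRderiv_euler_maclaurin (N : nat) (s : C) (x t : R) :
  0 < x + t ->
  CRderiv (fun u => Cpsum (fun j => RtoC (bern_poly j u) * pow_chain j s (x + u))%C N) t
    (- (RtoC (bern_poly N t) * pow_chain (S N) s (x + t)))%C.
Proof.
intros Hx. induction N as [|N IH].
- cbn [Cpsum]. apply CRderiv_ext with (fun u => pow_chain 0 s (x + u)).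
  { intros u. rewrite bern_poly_0. ring. }
  rewrite bern_poly_0. eapply CRderiv_eq.
  + apply CRderiv_shift. now apply CRderiv_pow_chain.
  + ring.
- cbn [Cpsum]. eapply CRderiv_eq.
  + apply CRderiv_plus; [apply IH|].
    apply CRderiv_mult.
    * apply CRderiv_RtoC, is_derive_bern_poly.
    * apply CRderiv_shift. now apply CRderiv_pow_chain.
  + cbv beta. ring.
Qed.

Definition em_boundary (N : nat) (s : C) (x : R) : C :=
  Cpsum (fun j => RtoC (bern_coef j) * pow_chain j s x)%C N.

(** The local error of the summation formula: the change of the boundary correction from x to x + 1,
    plus the new summand at x + 1. *)
Definition em_rest (N : nat) (s : C) (x : R) : C :=
  (em_boundary N s (x + 1) - em_boundary N s x + RCpow (x + 1) (- s))%C.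

Lemma em_rest_eq (N : nat) (s : C) (x : R) :
  em_rest (S N) s x =
  (Cpsum (fun j => RtoC (bern_poly j 1) * pow_chain j s (x + 1))%C (S N)
   - Cpsum (fun j => RtoC (bern_poly j 0) * pow_chain j s (x + 0))%C (S N))%C.
Proof.
unfold em_rest, em_boundary. rewrite Rplus_0_r.
rewrite (Cpsum_ext (fun j => RtoC (bern_poly j 0) * pow_chain j s x)%C
  (fun j => RtoC (bern_coef j) * pow_chain j s x)%C)
  by (intros; now rewrite bern_poly_at_0).
enough (H : (Cpsum (fun j => RtoC (bern_coef j) * pow_chain j s (x + 1)) (S N)
  + RCpow (x + 1) (- s)
  = Cpsum (fun j => RtoC (bern_poly j 1) * pow_chain j s (x + 1)) (S N))%C)
  by (rewrite <- H; ring).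
induction N as [|N IH].
- cbn [Cpsum]. rewrite bern_poly_0, bern_poly_1_at_1, RtoC_plus, bern_coef_0.
  replace (pow_chain 1 s (x + 1)) with (RCpow (x + 1) (- s)); [ring|].
  simpl. replace (- s - 0)%C with (- s)%C by ring. ring.
- cbn [Cpsum] in *. rewrite <- IH, bern_poly_at_1. ring.
Qed.

(** The linear combination serves two purposes: c = 0 bounds the remainder itself, and c = 1 bounds
    its variation in s. By [em_rest_eq] the left side is an increment over [0, 1], and its
    t-derivative carries only the last member of the chain. *)
Lemma em_rest_lin_bound (N : nat) (s s' : C) (c : C) (x D : R) :
  0 < x ->
  (forall y, x <= y -> Cmod (pow_chain (S (S N)) s y - c * pow_chain (S (S N)) s' y) <= D) ->
  Cmod (em_rest (S N) s x - c * em_rest (S N) s' x) <= 2 * (INR (S (S N)) * D).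
Proof.
intros Hx HD. rewrite !em_rest_eq.
set (G := fun s t => Cpsum (fun j => RtoC (bern_poly j t) * pow_chain j s (x + t))%C (S N)).
pose proof (CRderiv_bound_01 (fun t => G s t + (- c) * G s' t)%C
  (fun t => - (RtoC (bern_poly (S N) t) *
     (pow_chain (S (S N)) s (x + t) - c * pow_chain (S (S N)) s' (x + t))))%C
  (INR (S (S N)) * D)) as H.
cbv beta in H.
match goal with |- Cmod ?a <= _ =>
  replace a with (G s 1 + - c * G s' 1 - (G s 0 + - c * G s' 0))%C
    by (unfold G; ring) end.
apply H. intros t Ht. split.
- eapply CRderiv_eq.
  + apply CRderiv_plus; [|apply CRderiv_scal];
      apply CRderiv_euler_maclaurin; lra.
  + ring.
- rewrite Cmod_opp, Cmod_mult, Cmod_R.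
  apply Rmult_le_compat; [apply Rabs_pos|apply Cmod_ge_0| |].
  + now apply bern_poly_bound.
  + apply HD. lra.
Qed.

(** * Bernoulli numbers from their generating function *)

Lemma ex_pseries_radius (a : nat -> R) (x : R) :
  ex_pseries a x -> Rbar_le (Rabs x) (CV_radius a).
Proof.
intros [l H]. apply Rbar_not_lt_le. intros Hlt.
apply (CV_disk_outside a x Hlt).
apply is_lim_seq_ext with (fun n => scal (pow_n x n) (a n)).
{ intros n. rewrite pow_n_pow. apply Rmult_comm. }
apply (ex_series_lim_0 (fun n => scal (pow_n x n) (a n))). now exists l.
Qed.

Lemma ball_R_0 (e : posreal) (x : R) : ball (0 : R) e x <-> Rabs x < e.
Proof.
unfold ball; simpl. unfold AbsRing_ball, abs, minus, plus, opp; simpl.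
now replace (x + - 0) with x by ring.
Qed.

Lemma pseries_radius_locally' (a : nat -> R) (f : R -> R) :
  locally' (0 : R) (fun x => is_pseries a x (f x)) ->
  locally' (0 : R)
    (fun x => is_pseries a x (f x) /\ Rbar_lt (Rabs x) (CV_radius a)).
Proof.
intros [e He]. exists e. intros x Hx Hx0. split; [now apply He|].
apply -> ball_R_0 in Hx. pose proof (cond_pos e). pose proof (Rabs_pos x).
(* The series also converges at this midpoint, which makes the inequality for the radius strict. *)
set (y := (Rabs x + e) / 2).
apply (Rbar_lt_le_trans _ (Finite y)); [simpl; unfold y; lra|].
assert (Hy : Rabs y = y) by (apply Rabs_pos_eq; unfold y; lra).
rewrite <- Hy. apply ex_pseries_radius. exists (f y). apply He.
- apply <- ball_R_0. rewrite Hy. unfold y; lra.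
- apply Rgt_not_eq. unfold y; lra.
Qed.

Lemma pseries_locally'_unique (a b : nat -> R) (f : R -> R) (n : nat) :
  locally' (0 : R) (fun x => is_pseries a x (f x)) ->
  locally' (0 : R) (fun x => is_pseries b x (f x)) -> a n = b n.
Proof.
intros Ha Hb.
apply pseries_radius_locally' in Ha. apply pseries_radius_locally' in Hb.
destruct (filter_and _ _ Ha Hb) as [e He]. clear Ha Hb.
pose proof (cond_pos e) as Hpe.
assert (Hr : forall x, 0 < x < e ->
  PSeries a x = PSeries b x /\ Rbar_lt 0 (CV_radius a) /\ Rbar_lt 0 (CV_radius b)).
{ intros x Hx. assert (Ex : Rabs x = x) by (apply Rabs_pos_eq; lra).
  destruct (He x) as [[H1 H2] [H3 H4]].
  - apply <- ball_R_0. lra.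
  - apply Rgt_not_eq; lra.
  - rewrite (is_pseries_unique _ _ _ H1), (is_pseries_unique _ _ _ H3).
    rewrite Ex in *.
    split; [easy|split]; eapply Rbar_le_lt_trans; try eassumption; simpl; lra. }
destruct (Hr (e / 2)) as [_ [Ra Rb]]; [lra|].
apply PSeries_ext_recip; [exact Ra|exact Rb|].
exists e. intros x Hx.
destruct (Req_dec x 0) as [->|Hx0].
(* The hypotheses say nothing at 0. Both sums are continuous there and agree at arbitrarily small y
   > 0, so a nonzero difference at 0 would be smaller than itself. *)
- assert (Hc : continuity_pt (fun x => PSeries a x - PSeries b x) 0).
  { apply continuity_pt_minus; apply PSeries_continuity; now rewrite Rabs_R0. }
  apply Rminus_diag_uniq. apply NNPP. intros Hn.
  assert (Hpos : 0 < Rabs (PSeries a 0 - PSeries b 0)) by now apply Rabs_pos_lt.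
  apply continuity_pt_locally with (eps := mkposreal _ Hpos) in Hc.
  destruct Hc as [d Hd]. pose proof (cond_pos d).
  set (y := Rmin e d / 2).
  assert (Hy : 0 < y < e /\ y < d).
  { pose proof (Rmin_l e d). pose proof (Rmin_r e d).
    assert (0 < Rmin e d) by (now apply Rmin_glb_lt). unfold y. lra. }
  specialize (Hd y). simpl in Hd.
  rewrite (proj1 (Hr y ltac:(lra))) in Hd.
  rewrite Rminus_diag, Rminus_0_l, Rabs_Ropp in Hd.
  enough (Rabs (PSeries a 0 - PSeries b 0) < Rabs (PSeries a 0 - PSeries b 0)) by lra.
  apply Hd. apply <- ball_R_0. rewrite Rabs_pos_eq; lra.
- destruct (He x Hx Hx0) as [[H1 _] [H3 _]].
  now rewrite (is_pseries_unique _ _ _ H1), (is_pseries_unique _ _ _ H3).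
Qed.

Definition monomial_coef (m n : nat) : R := if Nat.eqb n m then 1 else 0.

Lemma is_pseries_monomial (m : nat) (x : R) : is_pseries (monomial_coef m) x (x ^ m).
Proof.
assert (E : forall n, sum_n (fun k => scal (pow_n x k) (monomial_coef m k)) n
  = if Nat.leb m n then x ^ m else 0).
{ induction n as [|n IH].
  - rewrite sum_O, pow_n_pow. unfold monomial_coef. destruct m as [|m]; simpl.
    + apply Rmult_1_l.
    + apply Rmult_0_r.
  - rewrite sum_Sn, IH, (pow_n_pow x (S n)). unfold monomial_coef.
    change (@plus _) with Rplus. change (@scal _ _) with Rmult.
    destruct (Nat.eqb_spec (S n) m) as [<-|Hne].
    + rewrite Nat.leb_refl. replace (Nat.leb (S n) n) with false
        by (symmetry; apply Nat.leb_gt; lia).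
      rewrite Rmult_1_r. apply Rplus_0_l.
    + rewrite Rmult_0_r.
      destruct (Nat.leb_spec m n); destruct (Nat.leb_spec m (S n)); try lia;
        apply Rplus_0_r. }
enough (H : is_lim_seq (sum_n (fun k => scal (pow_n x k) (monomial_coef m k))) (x ^ m))
  by exact H.
apply is_lim_seq_ext_loc with (fun _ => x ^ m); [|apply is_lim_seq_const].
exists m. intros n Hn. rewrite E. now replace (Nat.leb m n) with true
  by (symmetry; now apply Nat.leb_le).
Qed.

(** Near 0, the generating series times the series [c] of (e^x - 1) / x is the constant 1. By
    uniqueness of coefficients the Cauchy product is 1, 0, 0, ..., which is the recurrence defining
    [bern_coef]. *)
Lemma bernoulli_numbers_coef (B : nat -> R) :
  bernoulli_numbers B -> forall n, B n / INR (fact n) = bern_coef n.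
Proof.
intros HB.
set (a := fun n => B n / INR (fact n)).
set (c := PS_decr_1 (fun n => / INR (fact n))).
assert (Hm : forall n, PS_mult a c n = monomial_coef 0 n).
{ intros n. apply (pseries_locally'_unique _ _ (fun _ => 1)).
  - destruct (pseries_radius_locally' a (fun x => x / (exp x - 1)) HB) as [e He].
    (* The radius of [c] is only bounded below by 1 here, hence the minimum with 1. *)
    exists (mkposreal (Rmin e 1) (Rmin_pos _ _ (cond_pos e) Rlt_0_1)).
    intros x Hx Hx0. apply -> ball_R_0 in Hx. simpl in Hx.
    pose proof (Rmin_l e 1). pose proof (Rmin_r e 1).
    destruct (He x) as [H1 H2]; [apply <- ball_R_0; lra|exact Hx0|].
    assert (Rc : Rbar_lt (Rabs x) (CV_radius c)).
    { apply (Rbar_lt_le_trans _ (Finite 1)); [simpl; lra|]. apply CV_radius_ge_1.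
      intros k. unfold c, PS_decr_1.
      rewrite Rabs_pos_eq by (apply Rlt_le, inv_fact_pos).
      eapply Rle_trans; [apply inv_fact_le|].
      rewrite <- (pow1 k). apply pow_incr; lra. }
    assert (Hc : is_pseries c x (/ x * (exp x - 1))).
    { replace (exp x - 1) with (exp x - / INR (fact 0))
        by (simpl; rewrite Rinv_1; ring).
      apply (is_pseries_decr_1 (K := R_AbsRing) (V := R_NormedModule)
        (fun n => / INR (fact n)) x (/ x) (exp x)).
      - exact (Rinv_l x Hx0).
      - apply is_exp_Reals. }
    assert (He1 : exp x - 1 <> 0).
    { intros E. apply Hx0. apply exp_inv. rewrite exp_0. lra. }
    replace 1 with (x / (exp x - 1) * (/ x * (exp x - 1)))
      by (field; split; [exact Hx0|exact He1]).
    now apply is_pseries_mult.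
  - exists (mkposreal 1 Rlt_0_1). intros x _ _. exact (is_pseries_monomial 0 x). }
intros n. change (a n = bern_coef n).
induction n as [n IH] using lt_wf_ind.
specialize (Hm n). unfold PS_mult, monomial_coef in Hm. destruct n as [|n].
- simpl in Hm. unfold c, PS_decr_1 in Hm. simpl in Hm. rewrite bern_coef_0. lra.
- rewrite tech5, Nat.sub_diag in Hm. rewrite bern_coef_S.
  replace (c O) with 1 in Hm
    by (unfold c, PS_decr_1; simpl; symmetry; apply Rinv_1).
  simpl Nat.eqb in Hm. cbv iota in Hm.
  rewrite (sum_eq _ (fun j => bern_coef j * / INR (fact (S (S n - j))))) in Hm.
  + lra.
  + intros i Hi. now rewrite IH by lia.
Qed.

Lemma bern_coef_gen :
  locally' (0 : R) (fun x => is_pseries bern_coef x (x / (exp x - 1))).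
Proof.
destruct bernoulli_numbers_exist as [B HB].
destruct (HB) as [e He]. exists e. intros x Hx Hx0.
apply is_pseries_ext with (2 := He x Hx Hx0).
intros n. now apply bernoulli_numbers_coef.
Qed.

(** With g(x) = x / (e^x - 1) one has g(-x) = g(x) + x; the coefficients of both sides are
    compared. *)
Lemma bern_coef_parity (n : nat) :
  (-1) ^ n * bern_coef n = bern_coef n + monomial_coef 1 n.
Proof.
destruct bern_coef_gen as [e He].
apply (pseries_locally'_unique (fun n => (-1) ^ n * bern_coef n)
  (fun n => bern_coef n + monomial_coef 1 n) (fun x => x / (exp x - 1) + x ^ 1)).
- exists e. intros x Hx Hx0. apply -> ball_R_0 in Hx.
  assert (H : is_pseries bern_coef (- x) (- x / (exp (- x) - 1))).
  { apply He; [apply <- ball_R_0; now rewrite Rabs_Ropp|].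
    intros E. apply Hx0. change (@eq R (- x) 0) in E. change (@eq R x 0). lra. }
  assert (He1 : exp x - 1 <> 0).
  { intros E. apply Hx0. apply exp_inv. rewrite exp_0. lra. }
  pose proof (exp_pos x).
  replace (x / (exp x - 1) + x ^ 1) with (- x / (exp (- x) - 1)).
  + apply is_series_ext with (2 := H). intros k.
    change ((- x) ^ k * bern_coef k = x ^ k * ((-1) ^ k * bern_coef k)).
    replace (- x) with (-1 * x) by ring. rewrite Rpow_mult_distr.
    ring.
  + rewrite exp_Ropp. field. repeat split; try lra.
- exists e. intros x Hx Hx0.
  apply (is_pseries_plus (K := R_AbsRing) (V := R_NormedModule)).
  + now apply He.
  + apply is_pseries_monomial.
Qed.

(** * The zeta function *)

Lemma Rpower_neg_le_inv_sqr (x y a : R) :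
  1 <= x <= y -> a <= -2 -> Rpower y a <= / x ^ 2.
Proof.
intros Hxy Ha. apply Rle_trans with (Rpower y (- INR 2)).
- apply Rle_Rpower; [lra|]. simpl; lra.
- rewrite Rpower_Ropp, Rpower_pow by lra.
  apply Rinv_le_contravar; [apply pow_lt; lra|]. apply pow_incr; lra.
Qed.

Lemma pow_chain_S_bound (N : nat) (s : C) (x y : R) :
  1 <= x <= y -> 2 <= Re s + INR N ->
  Cmod (pow_chain (S N) s y) <= Cmod (Cpoch N s) / x ^ 2.
Proof.
intros Hxy Hs. unfold pow_chain. rewrite Cmod_mult, Cmod_RCpow.
apply Rmult_le_compat_l; [apply Cmod_ge_0|].
apply Rpower_neg_le_inv_sqr; [exact Hxy|]. unfold Re in *; simpl. lra.
Qed.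

Lemma Cdiff_Cpoch (N : nat) (s : C) : Cdifferentiable (Cpoch N) s.
Proof.
induction N as [|N IH]; simpl; [apply Cdiff_const|].
apply Cdiff_mult; [exact IH|].
apply Cdiff_plus; [apply Cdiff_id|apply Cdiff_const].
Qed.

(** In [Cexp_taylor0] at w = - h ln y, both ln y and e^(|h| ln y) are at most y, since |h| <= 1;
    this gives the factor y^2. *)
Lemma RCpow_opp_sub_1_bound (h : C) (y : R) :
  1 <= y -> Cmod h <= 1 -> Cmod (RCpow y (- h) - 1) <= 2 * Cmod h * y ^ 2.
Proof.
intros Hy Hh. unfold RCpow.
eapply Rle_trans; [apply Cexp_taylor0|].
assert (Hln : 0 <= ln y) by (rewrite <- ln_1; apply ln_le; lra).
assert (Hln2 : ln y <= y).
{ pose proof (exp_ineq1_le (ln y)). rewrite exp_ln in H by lra. lra. }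
rewrite Cmod_mult, Cmod_opp, Cmod_R, (Rabs_pos_eq (ln y)) by exact Hln.
pose proof (Cmod_ge_0 h).
replace (2 * Cmod h * y ^ 2) with (2 * (Cmod h * y * y)) by ring.
apply Rmult_le_compat_l; [lra|].
apply Rmult_le_compat.
- now apply Rmult_le_pos.
- apply Rlt_le, exp_pos.
- now apply Rmult_le_compat_l.
- rewrite <- (exp_ln y) at 2 by lra. apply exp_le_mono. nra.
Qed.

(** The increment splits into that of the polynomial factor and that of the power. The second costs
    y^2 by [RCpow_opp_sub_1_bound], so a decay exponent of 4 is asked in order to keep 1 / x^2. The
    first costs only a shift of the exponent by at most 1. *)
Lemma pow_chain_S_lipschitz (N : nat) (s : C) :
  4 <= Re s + INR N ->
  exists K r, 0 < r <= 1 /\ forall h x y, Cmod h < r -> 1 <= x <= y ->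
    Cmod (pow_chain (S N) (s + h) y - pow_chain (S N) s y)
    <= K / x ^ 2 * Cmod h.
Proof.
intros Hs.
destruct (Cdiff_lipschitz _ _ (Cdiff_Cpoch N s)) as [K0 [r0 [HK0 [Hr0 HL]]]].
exists (K0 + 2 * Cmod (Cpoch N s)), (Rmin r0 1).
split; [split; [apply Rmin_glb_lt; lra|apply Rmin_r]|].
intros h x y Hh Hxy.
pose proof (Rmin_l r0 1). pose proof (Rmin_r r0 1).
assert (Hrh : - Re h <= 1).
{ pose proof (Re_le_Cmod h). pose proof (Rle_abs (- Re h)) as Ha.
  rewrite Rabs_Ropp in Ha. lra. }
unfold pow_chain.
replace (- (s + h) - RtoC (INR N))%C with ((- s - RtoC (INR N)) + (- h))%C by ring.
rewrite RCpow_plus.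
set (p := RCpow y (- s - RtoC (INR N))).
replace (Cpoch N (s + h) * (p * RCpow y (- h)) - Cpoch N s * p)%C
  with ((Cpoch N (s + h) - Cpoch N s) * (p * RCpow y (- h))
        + Cpoch N s * (p * (RCpow y (- h) - 1)))%C by ring.
eapply Rle_trans; [apply Cmod_triangle|].
unfold Rdiv. rewrite Rmult_assoc, Rmult_plus_distr_r.
pose proof (Cmod_ge_0 h).
assert (Hx2 : 0 < / x ^ 2) by (apply Rinv_0_lt_compat, pow_lt; lra).
apply Rplus_le_compat.
- replace (K0 * (/ x ^ 2 * Cmod h)) with (K0 * Cmod h * / x ^ 2) by ring.
  rewrite Cmod_mult. apply Rmult_le_compat; try apply Cmod_ge_0.
  + apply HL. lra.
  + unfold p. rewrite <- RCpow_plus, Cmod_RCpow.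
    apply Rpower_neg_le_inv_sqr; [exact Hxy|]. unfold Re in *; simpl. lra.
- replace (2 * Cmod (Cpoch N s) * (/ x ^ 2 * Cmod h))
    with (Cmod (Cpoch N s) * (/ x ^ 2 * (2 * Cmod h))) by ring.
  rewrite Cmod_mult. apply Rmult_le_compat_l; [apply Cmod_ge_0|].
  rewrite Cmod_mult.
  apply Rle_trans with (Cmod p * (2 * Cmod h * y ^ 2)).
  { apply Rmult_le_compat_l; [apply Cmod_ge_0|].
    apply RCpow_opp_sub_1_bound; lra. }
  replace (Cmod p * (2 * Cmod h * y ^ 2)) with (Cmod p * y ^ 2 * (2 * Cmod h)) by ring.
  apply Rmult_le_compat_r; [lra|].
  unfold p. rewrite Cmod_RCpow, <- (Rpower_pow 2 y), <- Rpower_plus by lra.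
  apply Rpower_neg_le_inv_sqr; [exact Hxy|]. unfold Re in *; simpl. lra.
Qed.

Lemma Cdiff_pow_chain (j : nat) (x : R) (s : C) :
  Cdifferentiable (fun w => pow_chain j w x) s.
Proof.
destruct j as [|m]; simpl.
- apply Cdiff_ext with
    (fun w => (- RtoC (ln x)) * Cexpq ((1 - w) * RtoC (ln x)))%C.
  { intros w. ring. }
  apply Cdiff_mult; [apply Cdiff_const|].
  apply (Cdiff_comp Cexpq); [apply Cdiff_Cexpq|].
  apply Cdiff_mult; [|apply Cdiff_const].
  apply Cdiff_minus; [apply Cdiff_const|apply Cdiff_id].
- apply Cdiff_mult; [apply Cdiff_Cpoch|].
  apply (Cdiff_comp Cexp); [apply Cdiff_Cexp|].
  apply Cdiff_mult; [|apply Cdiff_const].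
  apply Cdiff_ext with (fun w => (0 - w) - RtoC (INR m))%C; [intros; ring|].
  repeat apply Cdiff_minus; try apply Cdiff_const. apply Cdiff_id.
Qed.

Lemma Cdiff_em_boundary (N : nat) (x : R) (s : C) :
  Cdifferentiable (fun w => em_boundary N w x) s.
Proof.
apply (Cdiff_Cpsum (fun j w => RtoC (bern_coef j) * pow_chain j w x)%C).
intros k _. apply Cdiff_mult; [apply Cdiff_const|apply Cdiff_pow_chain].
Qed.

Lemma Cdiff_em_rest (N : nat) (x : R) (s : C) :
  Cdifferentiable (fun w => em_rest N w x) s.
Proof.
apply Cdiff_plus.
- apply Cdiff_minus; apply Cdiff_em_boundary.
- apply Cdiff_ext with (fun w => pow_chain 1 w (x + 1)).
  + intros w. simpl. replace (- w - 0)%C with (- w)%C by ring. ring.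
  + apply Cdiff_pow_chain.
Qed.

Lemma em_rest_bound (N : nat) (s : C) (n : nat) :
  2 <= Re s + INR (S N) ->
  Cmod (em_rest (S N) s (INR (S n)))
  <= 2 * INR (S (S N)) * Cmod (Cpoch (S N) s) / INR (S n) ^ 2.
Proof.
intros Hs. assert (Hx : 1 <= INR (S n)) by (apply (le_INR 1); lia).
pose proof (em_rest_lin_bound N s s 0 (INR (S n))
  (Cmod (Cpoch (S N) s) / INR (S n) ^ 2)) as H.
rewrite Cmult_0_l in H. unfold Cminus in H. rewrite Copp_0, Cplus_0_r in H.
eapply Rle_trans; [apply H|right; unfold Rdiv; ring]; [lra|].
intros y Hy. rewrite Cmult_0_l, Copp_0, Cplus_0_r.
apply pow_chain_S_bound; [lra|exact Hs].
Qed.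

(** The Dirichlet sum runs over 1, ..., M + 2 and the correction is taken at M + 2. With this offset
    the remainders in [zeta_em_eq] run over x = 1, ..., M + 1, never an empty range, which [Cpsum]
    could not express. *)
Definition zeta_em (N : nat) (s : C) (M : nat) : C :=
  (Cpsum (fun k => nat_Cpower (S k) (- s)) (S M)
   + em_boundary N s (INR (S (S M))))%C.

Lemma zeta_em_eq (N : nat) (s : C) (M : nat) :
  zeta_em N s M =
  (1 + em_boundary N s 1 + Cpsum (fun k => em_rest N s (INR (S k))) M)%C.
Proof.
unfold zeta_em. induction M as [|M IH].
- cbn [Cpsum]. unfold em_rest. rewrite <- S_INR.
  (* At an integer argument, [RCpow] and [nat_Cpower] agree by conversion. *)
  change (nat_Cpower 2 (- s)) with (RCpow (INR 2) (- s)).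
  change (nat_Cpower 1 (- s)) with (RCpow (INR 1) (- s)).
  change (INR 1) with 1. rewrite RCpow_1_l. ring.
- cbn [Cpsum] in *. rewrite Cplus_assoc, <- IH. unfold em_rest. rewrite <- S_INR.
  change (nat_Cpower (S (S (S M))) (- s)) with (RCpow (INR (S (S (S M)))) (- s)).
  ring.
Qed.

Lemma zeta_em_cv (N : nat) (s : C) :
  2 <= Re s + INR (S N) ->
  Ccv (zeta_em (S N) s)
    (1 + em_boundary (S N) s 1 + Csum (fun k => em_rest (S N) s (INR (S k))))%C.
Proof.
intros Hs. eapply Ccv_ext; [intros n; symmetry; apply zeta_em_eq|].
apply Ccv_plus; [apply Ccv_const|].
eapply Csum_cv; [intros n; now apply em_rest_bound|]. apply ex_series_inv_sqr.
Qed.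

Lemma is_lim_seq_Rpower_neg (a : R) :
  a < 0 -> is_lim_seq (fun n => Rpower (INR (S (S n))) a) 0.
Proof.
intros Ha. unfold Rpower.
apply (is_lim_seq_incr_1 (fun n => exp (a * ln (INR (S n))))).
apply (is_lim_seq_incr_1 (fun n => exp (a * ln (INR n)))).
apply (filterlim_comp _ _ _ (fun n => a * ln (INR n)) exp _ (Rbar_locally m_infty)).
- assert (H : is_lim_seq (fun n => ln (INR n)) p_infty).
  { apply (filterlim_comp _ _ _ INR ln _ (Rbar_locally p_infty)).
    - apply is_lim_seq_INR.
    - apply is_lim_ln_p. }
  apply (is_lim_seq_scal_l _ a) in H.
  replace (Rbar_mult a p_infty) with m_infty in H; [exact H|].
  symmetry. apply is_Rbar_mult_unique, is_Rbar_mult_sym.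
  now apply is_Rbar_mult_p_infty_neg.
- apply is_lim_exp_m.
Qed.

Lemma RCpow_cv_0 (a : C) : Re a < 0 -> Ccv (fun n => RCpow (INR (S (S n))) a) 0.
Proof.
intros Ha. apply Ccv_0 with (fun n => Rpower (INR (S (S n))) (Re a)).
- intros n. rewrite Cmod_RCpow. lra.
- now apply is_lim_seq_Rpower_neg.
Qed.

Lemma pow_chain_S_cv_0 (m : nat) (s : C) :
  0 < Re s + INR m -> Ccv (fun n => pow_chain (S m) s (INR (S (S n)))) 0.
Proof.
intros Hs. unfold pow_chain.
replace (RtoC 0) with (Cpoch m s * 0)%C by ring.
apply Ccv_scal, RCpow_cv_0. unfold Re in *; simpl. lra.
Qed.

Lemma em_boundary_S (N : nat) (s : C) (x : R) :
  em_boundary (S N) s x =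
  (em_boundary N s x + RtoC (bern_coef (S N)) * pow_chain (S N) s x)%C.
Proof. reflexivity. Qed.

(** Raising the order adds a single boundary term, of size (M + 2)^(- Re s - N), which tends to 0.
    Hence the limit does not depend on the order. *)
Lemma zeta_em_cv_S (N : nat) (s l : C) :
  0 < Re s + INR N -> Ccv (zeta_em N s) l -> Ccv (zeta_em (S N) s) l.
Proof.
intros Hs H.
apply Ccv_ext with (fun n => zeta_em N s n
  + RtoC (bern_coef (S N)) * pow_chain (S N) s (INR (S (S n))))%C.
{ intros n. unfold zeta_em. rewrite em_boundary_S. ring. }
replace l with (l + RtoC (bern_coef (S N)) * 0)%C by ring.
apply Ccv_plus; [exact H|]. apply Ccv_scal. now apply pow_chain_S_cv_0.
Qed.

Lemma zeta_em_cv_add (N m : nat) (s l : C) :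
  0 < Re s + INR N -> Ccv (zeta_em N s) l -> Ccv (zeta_em (m + N) s) l.
Proof.
intros Hs H. induction m as [|m IH]; [exact H|].
apply zeta_em_cv_S; [|exact IH].
rewrite plus_INR. pose proof (pos_INR m). lra.
Qed.

(** The margin 5 covers the exponent 4 of [pow_chain_S_lipschitz] and leaves room for moving s by
    less than 1. At s = -k the order also exceeds k. *)
Definition zeta_order (s : C) : nat := Z.to_nat (up (Rabs (Re s) + 5)).

Lemma zeta_order_ge (s : C) : Rabs (Re s) + 5 <= INR (zeta_order s).
Proof.
unfold zeta_order. destruct (archimed (Rabs (Re s) + 5)) as [H _].
pose proof (Rabs_pos (Re s)).
rewrite INR_IZR_INZ, Z2Nat.id; [lra|].
apply le_IZR. lra.
Qed.

Lemma zeta_order_S_ge (s : C) : 5 <= Re s + INR (S (zeta_order s)).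
Proof.
pose proof (zeta_order_ge s). rewrite S_INR.
pose proof (Rle_abs (- Re s)) as H1. rewrite Rabs_Ropp in H1. lra.
Qed.

Definition zeta_reg (s : C) : C :=
  (1 + em_boundary (S (zeta_order s)) s 1
   + Csum (fun k => em_rest (S (zeta_order s)) s (INR (S k))))%C.

(** The order chosen in [zeta_reg] jumps as s varies; this lemma allows any admissible fixed order
    instead. The limits for the two orders are compared at the sum of the orders. *)
Lemma zeta_reg_cv (N : nat) (s : C) :
  2 <= Re s + INR (S N) -> Ccv (zeta_em (S N) s) (zeta_reg s).
Proof.
intros Hs. pose proof (zeta_order_S_ge s) as H0.
set (N0 := zeta_order s) in *.
pose proof (zeta_em_cv N s Hs) as H1.
assert (H2 : Ccv (zeta_em (S N0) s) (zeta_reg s)) by (apply zeta_em_cv; lra).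
pose proof (zeta_em_cv_add (S N) (S N0) s _ ltac:(lra) H1) as H3.
pose proof (zeta_em_cv_add (S N0) (S N) s _ ltac:(lra) H2) as H4.
rewrite Nat.add_comm in H4. now rewrite (Ccv_unique _ _ _ H4 H3).
Qed.

(** The order chosen at s stays admissible for all nearby s + h, so it is frozen. The boundary part
    is differentiable outright, and the rest is a series with summable Lipschitz constants at s. *)
Lemma Cdiff_zeta_reg (s : C) : Cdifferentiable zeta_reg s.
Proof.
pose proof (zeta_order_S_ge s) as Hs. set (N := zeta_order s) in *.
destruct (pow_chain_S_lipschitz (S N) s ltac:(lra)) as [K [r [Hr HL]]].
apply Cdiff_ext with (fun w => 1 + em_boundary (S N) w 1
  + (zeta_reg w - (1 + em_boundary (S N) w 1)))%C; [intros; ring|].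
apply Cdiff_plus.
{ apply Cdiff_plus; [apply Cdiff_const|apply Cdiff_em_boundary]. }
apply (Cdiff_series (fun n w => em_rest (S N) w (INR (S n)))) with
  (M := fun n => 2 * INR (S (S N)) * K / INR (S n) ^ 2) (r := r).
- lra.
- apply ex_series_inv_sqr.
- intros n. apply Cdiff_em_rest.
- intros n h Hh. assert (Hx : 1 <= INR (S n)) by (apply (le_INR 1); lia).
  pose proof (em_rest_lin_bound N (s + h) s 1 (INR (S n))
    (K / INR (S n) ^ 2 * Cmod h)) as H.
  rewrite Cmult_1_l in H.
  eapply Rle_trans; [apply H|right; unfold Rdiv; ring]; [lra|].
  intros y Hy. rewrite Cmult_1_l. apply HL; [exact Hh|lra].
- intros h Hh.
  assert (Hsh : 2 <= Re (s + h) + INR (S N)).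
  { pose proof (Re_le_Cmod h). pose proof (Rle_abs (- Re h)) as H1.
    rewrite Rabs_Ropp in H1. change (Re (s + h)%C) with (Re s + Re h). lra. }
  apply Ccv_ext with (fun n => zeta_em (S N) (s + h) n
    - (1 + em_boundary (S N) (s + h) 1))%C.
  { intros n. rewrite zeta_em_eq. ring. }
  apply Ccv_minus; [now apply zeta_reg_cv|apply Ccv_const].
Qed.

Definition zeta (s : C) : C := (/ (s - 1) + zeta_reg s)%C.

(** Here F_0(x) = (1 - x^(1 - s)) / (1 - s) tends to 1 / (1 - s), while every later F_j tends to 0.
    This limit is what the polar term of [zeta] compensates. *)
Lemma em_boundary_cv (N : nat) (s : C) :
  1 < Re s -> Ccv (fun n => em_boundary N s (INR (S (S n)))) (/ (1 - s))%C.
Proof.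
intros Hs.
assert (Hs1 : s <> 1%C) by (intros ->; simpl in Hs; lra).
assert (H : (1 - s)%C <> 0%C).
{ intros H. apply Hs1. replace s with (1 - (1 - s))%C by ring. rewrite H. ring. }
induction N as [|N IH]; unfold em_boundary in *; cbn [Cpsum].
- apply Ccv_ext with
    (fun n => / (1 - s) - / (1 - s) * RCpow (INR (S (S n))) (1 - s))%C.
  { intros n. rewrite pow_chain_0_eq, bern_coef_0 by exact Hs1. field. exact H. }
  replace (/ (1 - s))%C with (/ (1 - s) - / (1 - s) * 0)%C at 1 by ring.
  apply Ccv_minus; [apply Ccv_const|]. apply Ccv_scal, RCpow_cv_0.
  unfold Re in *; simpl. lra.
- replace (/ (1 - s))%C with (/ (1 - s) + RtoC (bern_coef (S N)) * 0)%C by ring.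
  apply Ccv_plus; [exact IH|]. apply Ccv_scal, pow_chain_S_cv_0.
  pose proof (pos_INR N). lra.
Qed.

Lemma is_series_zeta (s : C) :
  1 < Re s -> is_series (fun n => nat_Cpower (S n) (- s)%C) (zeta s).
Proof.
intros Hs. apply is_series_Ccv. apply Ccv_S.
assert (Hs1 : s <> 1%C) by (intros ->; simpl in Hs; lra).
(* Removing the boundary correction leaves the bare partial sums, whose index is shifted by one,
   whence [Ccv_S] above. *)
apply Ccv_ext with (fun n => zeta_em 2 s n - em_boundary 2 s (INR (S (S n))))%C.
{ intros n. unfold zeta_em. ring. }
replace (zeta s) with (zeta_reg s - / (1 - s))%C.
- apply Ccv_minus; [|now apply em_boundary_cv].
  apply zeta_reg_cv. simpl. lra.
- unfold zeta. field.
  split; intros H; apply Hs1.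
  + replace s with (s - 1 + 1)%C by ring. rewrite H. ring.
  + replace s with (1 - (1 - s))%C by ring. rewrite H. ring.
Qed.

Lemma Cdiff_zeta (s : C) : s <> 1%C -> Cdifferentiable zeta s.
Proof.
intros Hs. apply Cdiff_plus; [|apply Cdiff_zeta_reg].
apply (Cdiff_comp Cinv (fun w => w - 1)%C).
- apply Cdiff_inv. intros H. apply Hs.
  replace s with (s - 1 + 1)%C by ring. rewrite H. ring.
- apply Cdiff_minus; [apply Cdiff_id|apply Cdiff_const].
Qed.

(** * Values at the negative integers *)

Lemma Cpoch_opp_nat (k m : nat) :
  (m <= k)%nat ->
  Cpoch m (RtoC (- INR k)) =
  RtoC ((-1) ^ m * (INR (fact k) / INR (fact (k - m)))).
Proof.
induction m as [|m IH]; intros Hm; simpl Cpoch.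
- rewrite Nat.sub_0_r. f_equal. simpl. field. apply INR_fact_neq_0.
- rewrite IH by lia. rewrite <- RtoC_plus, <- RtoC_mult. f_equal.
  replace (k - m)%nat with (S (k - S m)) by lia.
  rewrite fact_simpl, mult_INR.
  assert (E : - INR k + INR m = - INR (S (k - S m))).
  { replace (S (k - S m)) with (k - m)%nat by lia.
    rewrite minus_INR by lia. ring. }
  rewrite E. simpl pow. field.
  split; [apply INR_fact_neq_0|apply not_0_INR; lia].
Qed.

Lemma Cpoch_opp_nat_eq_0 (k m : nat) :
  (k < m)%nat -> Cpoch m (RtoC (- INR k)) = 0%C.
Proof.
induction m as [|m IH]; intros Hm; [lia|]. simpl.
destruct (Nat.eq_dec k m) as [->|Hne].
- rewrite RtoC_opp. ring.
- rewrite IH by lia. ring.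
Qed.

Lemma pow_chain_0_at_1 (s : C) : pow_chain 0 s 1 = 0%C.
Proof. simpl. rewrite ln_1. ring. Qed.

Lemma pow_chain_S_at_1 (m : nat) (s : C) : pow_chain (S m) s 1 = Cpoch m s.
Proof. simpl. rewrite RCpow_1_l. ring. Qed.

(** The true j = 0 term vanishes because F_0(1) = 0. The sum on the right is nevertheless started at
    j = 0, to fit the Bernoulli recurrence, and [/ INR (S k)] = k! / (k + 1)! cancels that extra
    term. *)
Lemma em_boundary_opp_nat (k n : nat) :
  (n <= S k)%nat ->
  em_boundary n (RtoC (- INR k)) 1 =
  RtoC (/ INR (S k) - INR (fact k) *
    sum_f_R0 (fun j => (-1) ^ j * bern_coef j * / INR (fact (S k - j))) n).
Proof.
unfold em_boundary. induction n as [|n IH]; intros Hn; cbn [Cpsum].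
- rewrite pow_chain_0_at_1. rewrite Cmult_0_r. f_equal. cbn [sum_f_R0].
  rewrite Nat.sub_0_r, bern_coef_0, fact_simpl, mult_INR. simpl pow. field.
  split; [apply INR_fact_neq_0|apply not_0_INR; lia].
- rewrite IH, pow_chain_S_at_1, Cpoch_opp_nat by lia.
  rewrite <- RtoC_mult, <- RtoC_plus. f_equal. rewrite tech5.
  replace (S k - S n)%nat with (k - n)%nat by lia. simpl pow. unfold Rdiv. ring.
Qed.

Lemma em_boundary_opp_nat_stable (k m : nat) :
  em_boundary (m + S k) (RtoC (- INR k)) 1 = em_boundary (S k) (RtoC (- INR k)) 1.
Proof.
induction m as [|m IH]; [reflexivity|].
rewrite Nat.add_succ_l, em_boundary_S, IH, pow_chain_S_at_1.
rewrite Cpoch_opp_nat_eq_0 by lia. ring.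
Qed.

(** By parity, (-1)^j b_j is b_j plus a correction at j = 1 only. The correction contributes 1 / k!.
    By [bern_coef_sum], which starts in degree 2 and so requires k >= 1, the b_j contribute only the
    last one. *)
Lemma sum_bern_coef_parity (k : nat) :
  (1 <= k)%nat ->
  sum_f_R0 (fun j => (-1) ^ j * bern_coef j * / INR (fact (S k - j))) (S k)
  = bern_coef (S k) + / INR (fact k).
Proof.
intros Hk.
rewrite (sum_eq _ (fun j => bern_coef j * / INR (fact (S k - j))
  + monomial_coef 1 j * / INR (fact (S k - j))))
  by (intros j _; rewrite bern_coef_parity; ring).
rewrite sum_plus. f_equal.
- destruct k as [|k]; [lia|]. rewrite tech5, bern_coef_sum, Nat.sub_diag.
  simpl fact. simpl INR. field.
- clear Hk. rewrite decomp_sum by lia. rewrite Nat.pred_succ.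
  destruct k as [|k].
  + unfold monomial_coef; simpl. field.
  + rewrite decomp_sum by lia. rewrite (sum_eq _ (fun _ => 0)).
    * rewrite sum_cte. unfold monomial_coef. simpl Nat.eqb. cbv iota.
      replace (S (S k) - 1)%nat with (S k) by lia. ring.
    * intros i _. unfold monomial_coef. simpl. ring.
Qed.

Lemma zeta_reg_opp_nat (k : nat) :
  zeta_reg (RtoC (- INR k)) = (1 + em_boundary (S k) (RtoC (- INR k)) 1)%C.
Proof.
set (s := RtoC (- INR k)).
assert (HN : (k < S (zeta_order s))%nat).
{ apply INR_lt. rewrite S_INR. pose proof (zeta_order_ge s) as H. unfold s in H at 1.
  simpl in H. rewrite Rabs_Ropp, Rabs_pos_eq in H by apply pos_INR. lra. }
pose proof (zeta_order_S_ge s) as Hs.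
unfold zeta_reg. set (N := zeta_order s) in *.
(* The bound of [em_rest_bound] has the factor [Cpoch (S N) s], which is zero at s = -k since N + 1
   > k. *)
assert (E0 : forall n, em_rest (S N) s (INR (S n)) = 0%C).
{ intros n. apply Cmod_eq_0, Rle_antisym; [|apply Cmod_ge_0].
  eapply Rle_trans; [apply em_rest_bound; lra|].
  unfold s. rewrite Cpoch_opp_nat_eq_0, Cmod_0 by lia. right. unfold Rdiv. ring. }
replace (Csum (fun n => em_rest (S N) s (INR (S n)))) with (RtoC 0).
- replace (S N) with ((N - k) + S k)%nat by lia.
  unfold s. rewrite em_boundary_opp_nat_stable. ring.
- unfold Csum, RtoC. f_equal; symmetry;
    rewrite (Series_ext _ (fun _ => 0 * 0)); try (intros n; rewrite E0; simpl; ring);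
    rewrite Series_scal_l; ring.
Qed.

(** The sum -1 / (k + 1) + 1 + 1 / (k + 1) - k! (b_(k+1) + 1 / k!) collapses to - k! b_(k+1). *)
Lemma zeta_opp_nat (k : nat) :
  (1 <= k)%nat ->
  zeta (RtoC (- INR k)) = RtoC (- (INR (fact k) * bern_coef (S k))).
Proof.
intros Hk. unfold zeta.
rewrite zeta_reg_opp_nat, em_boundary_opp_nat, sum_bern_coef_parity by lia.
assert (H : INR (S k) <> 0) by (apply not_0_INR; lia).
replace (RtoC (- INR k) - 1)%C with (RtoC (- INR (S k)))
  by (rewrite S_INR, !RtoC_opp, RtoC_plus; ring).
rewrite <- RtoC_inv by lra. rewrite <- !RtoC_plus. f_equal. field.
split; [apply INR_fact_neq_0|exact H].
Qed.

Theorem theorem3p2 :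
  exists zeta : C -> C,
    (forall s : C, 1 < Re s ->
       is_series (fun n : nat => nat_Cpower (S n) (- s)%C) (zeta s)) /\
    (forall s : C, s <> RtoC 1 -> analytic_at zeta s) /\
    simple_pole_with_residue zeta (RtoC 1) (RtoC 1) /\
    (forall B : nat -> R, bernoulli_numbers B ->
       forall k : nat, (1 <= k)%nat ->
         zeta (RtoC (- INR k)) = RtoC (- (B (k + 1)%nat / INR (k + 1)))).
Proof.
exists zeta. split; [exact is_series_zeta|]. split; [|split].
- intros s Hs.
  (* Balls of [C_NormedModule] are controlled in modulus only up to a factor sqrt 2, so this radius
     keeps the ball away from 1. *)
  assert (Hd : 0 < Cmod (s - 1) / sqrt 2).
  { apply Rdiv_lt_0_compat; [|apply sqrt_lt_R0; lra].
    apply Cmod_gt_0. intros H. apply Hs.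
    replace s with (s - 1 + 1)%C by ring. rewrite H. ring. }
  exists (mkposreal _ Hd). intros w Hw.
  destruct (Cdiff_zeta w) as [l Hl].
  + intros ->. apply C_NormedModule_mixin_compat2 in Hw. simpl in Hw.
    change (Cmod (1 - s) < sqrt 2 * (Cmod (s - 1) / sqrt 2)) in Hw.
    rewrite Cmod_minus_sym in Hw.
    replace (sqrt 2 * (Cmod (s - 1) / sqrt 2)) with (Cmod (s - 1)) in Hw; [lra|].
    field. apply Rgt_not_eq, sqrt_lt_R0. lra.
  + exists l. now apply Cderiv_is_derive.
- split.
  + intros H. apply RtoC_inj in H. lra.
  + exists zeta_reg. split.
    * exists (mkposreal 1 Rlt_0_1). intros w _.
      destruct (Cdiff_zeta_reg w) as [l Hl].
      exists l. now apply Cderiv_is_derive.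
    * exists (mkposreal 1 Rlt_0_1). intros w _ _.
      unfold zeta, Cdiv. now rewrite Cmult_1_l.
- intros B HB k Hk. rewrite zeta_opp_nat by exact Hk. f_equal.
  (* Here b_(k+1) = B_(k+1) / (k+1)!, and k! / (k+1)! leaves the denominator k + 1. *)
  rewrite <- (bernoulli_numbers_coef B HB), Nat.add_1_r, fact_simpl, mult_INR.
  field. split; [apply not_0_INR; lia|apply INR_fact_neq_0].
Qed.
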